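(* Let $P=\sum_{i=1}^m a_iX_iX_{m-i+1}$ ($m\ge2$) be a polynomial in noncommuting variables with $a_i\in\mathbb{C}^*$ such that, for some $\tau\in\{-1,1\}$, $a_i\bar a_{m-i+1}=-\tau$ for all $i$, and $\sum_{i=1}^m|a_i|^2>2$. Then $\mathcal{T}_P^{(0)}=C(\overline{\mathbb{F}O_P})$ (as subsets of $\ell^\infty(\mathbb{F}O_P)$).
   Context: Let $H=\mathbb{C}^m$ with its standard orthonormal basis, and identify the tensor algebra $T(H)$ with $\mathbb{C}\langle X_1,\dots,X_m\rangle$, so that the monomials $X_{i_1}\cdots X_{i_n}$ form an orthonormal basis of $H^{\otimes n}$. Let $I=\langle P\rangle$ be the two-sided ideal generated by $P$, $I_n\subset H^{\otimes n}$ its degree $n$ component, and $H_n=I_n^\perp\subset H^{\otimes n}$ (so $H_0=\mathbb{C}$, $H_1=H$ and $H_{k+l}\subset H_k\otimes H_l$). Let $f_n\colon H^{\otimes n}\to H_n$ be the orthogonal projection and $\mathcal{F}_P=\bigoplus_{n=0}^\infty H_n$ the Fock space. Define $S_i\in B(\mathcal{F}_P)$ by $S_i\zeta=f_{n+1}(X_i\zeta)$ for $\zeta\in H_n$. The Toeplitz algebra $\mathcal{T}_P$ is the unital C$^*$-algebra generated by $S_1,\dots,S_m$. Put $\ell^\infty(\mathbb{F}O_P)=\ell^\infty\text{-}\bigoplus_{n=0}^\infty B(H_n)\subset B(\mathcal{F}_P)$ (this is the algebra of bounded functions on the discrete dual $\mathbb{F}O_P$ of the free orthogonal quantum group of $P$,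 since the $H_n$ exhaust its irreducible representations). For $x\in\ell^\infty(\mathbb{F}O_P)$, $x_n$ denotes its component in $B(H_n)$. The gauge action $\sigma$ of the circle group $\mathbb{T}$ on $\mathcal{T}_P$ is given by $\sigma_z(S_i)=zS_i$ (implemented by the unitaries acting on $H_n$ by $z^n$). The gauge-invariant subalgebra is $\mathcal{T}_P^{(0)}=\mathcal{T}_P^\sigma=\mathcal{T}_P\cap\ell^\infty(\mathbb{F}O_P)$. For $n,k\ge0$ let $\psi_{n,n+k}\colon B(H_n)\to B(H_{n+k})$ be the unital completely positive map $\psi_{n,n+k}(T)=f_{n+k}(T\otimes1)f_{n+k}$ (using $H_{n+k}\subset H_n\otimes H_k$). Define $$C(\overline{\mathbb{F}O_P})=\overline{\{x\in\ell^\infty(\mathbb{F}O_P): \psi_{n,n+k}(x_n)=x_{n+k}\text{ for all } n\text{ large enough and all }k\ge0\}}$$ (norm closure), equivalently $C(\overline{\mathbb{F}O_P})=\{x\in\ell^\infty(\mathbb{F}O_P):\lim_{n\to+\infty}\sup_{k\ge0}\|\psi_{n,n+k}(x_n)-x_{n+k}\|=0\}$. *)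

(* Defs.v *)
From HB Require Import structures.
From mathcomp Require Import all_boot all_order all_algebra finmap.
From mathcomp Require Import all_classical all_reals all_analysis.
From mathcomp Require Import complex.
From mathcomp Require Import ring.
From mathcomp Require monalg.
(* The notations of monalg clash with those of mathcomp-analysis. *)
Import -(notations) monalg.

Set Implicit Arguments.
Unset Strict Implicit.
Unset Printing Implicit Defensive.

Import Order.TTheory GRing.Theory Num.Theory.
Import numFieldNormedType.Exports.

Local Open Scope classical_set_scope.
Local Open Scope ring_scope.

(* Naming R[i] as a numClosedFieldType makes the canonical topology available. *)
Definition cplx (R : realType) : numClosedFieldType := R[i].

(* The tensor algebra T(C^m), i.e. C<X_1, ..., X_m>. *)
Notation ncpoly C m := (malg (fmonom 'I_m) C).

Section NCPoly.
Context {C : numClosedFieldType} {m : nat}.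
Local Notation A := (ncpoly C m).
Implicit Types (p q h : A) (w : seq 'I_m) (n : nat).

Definition mon w : A := mkmalgU (FMonom w) 1.

Definition coef p w : C := mcoeff (FMonom w) p.

(* The inner product for which the monomials are orthonormal, linear in the
   first argument. *)
Definition dot p q : C := \sum_(w <- msupp p) coef p w * (coef q w)^*.

(* H^{(x) n} *)
Definition tpow n : set A := [set p | forall w, coef p w != 0 -> size w = n].

Lemma coefP p q : (forall w, coef p w = coef q w) -> p = q.
Proof. by move=> h; apply/malgP => -[w]; apply: h. Qed.

Lemma coefD p q w : coef (p + q) w = coef p w + coef q w.
Proof. exact: mcoeffD. Qed.

Lemma coefB p q w : coef (p - q) w = coef p w - coef q w.
Proof. exact: mcoeffB. Qed.

Lemma coefZ c p w : coef (c *: p) w = c * coef p w.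
Proof. exact: mcoeffZ. Qed.

Lemma coef0 w : coef 0 w = 0.
Proof. exact: mcoeff0. Qed.

Lemma coef_sum I r (Q : pred I) (F : I -> A) w :
  coef (\sum_(i <- r | Q i) F i) w = \sum_(i <- r | Q i) coef (F i) w.
Proof. exact: raddf_sum. Qed.

Lemma coef_mon u w : coef (mon u) w = (u == w)%:R.
Proof. by rewrite /coef mcoeffU1 -val_eqE. Qed.

Lemma coefZ_mon c u w : coef (c *: mon u) w = if u == w then c else 0.
Proof. by rewrite coefZ coef_mon; case: eqP; rewrite ?mulr1 ?mulr0. Qed.

Lemma ncpolyE p : p = \sum_(w <- msupp p) coef p w *: mon w.
Proof.
rewrite {1}(monalgE p); apply: eq_bigr => -[w] _; apply/coefP => u.
by rewrite [RHS]coefZ_mon {1}/coef mcoeffU -val_eqE/=; case: eqP.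
Qed.

Lemma dotEw (d : {fset fmonom 'I_m}) p q : (msupp p `<=` d)%fset ->
  dot p q = \sum_(w <- d) coef p w * (coef q w)^*.
Proof.
move=> pd; rewrite /dot; apply/big_fset_incl => // -[w] _ /mcoeff_outdom pw.
by rewrite /coef/= pw mul0r.
Qed.

Lemma dotPl c p1 p2 q : dot (c *: p1 + p2) q = c * dot p1 q + dot p2 q.
Proof.
pose d := (msupp p1 `|` msupp p2)%fset.
rewrite (@dotEw d p1) ?fsubsetUl// (@dotEw d p2) ?fsubsetUr//.
rewrite (@dotEw d); last first.
  by apply: (fsubset_trans (msuppD_le _ _)); apply: fsetSU; exact: msuppZ_le.
rewrite mulr_sumr -big_split/=; apply: eq_bigr => w _.
by rewrite coefD coefZ mulrDl mulrA.
Qed.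

Lemma dotC p q : dot q p = (dot p q)^*.
Proof.
pose d := (msupp p `|` msupp q)%fset.
rewrite (@dotEw d p) ?fsubsetUl// (@dotEw d q) ?fsubsetUr//.
rewrite rmorph_sum; apply: eq_bigr => w _.
by rewrite rmorphM/= conjCK mulrC.
Qed.

Lemma dot0l q : dot 0 q = 0.
Proof. by rewrite /dot msupp0 big_seq_fset0. Qed.

Lemma dotDl p1 p2 q : dot (p1 + p2) q = dot p1 q + dot p2 q.
Proof. by rewrite -{1}[p1]scale1r dotPl mul1r. Qed.

Lemma dotZl c p q : dot (c *: p) q = c * dot p q.
Proof. by rewrite -[c *: p]addr0 dotPl dot0l addr0. Qed.

Lemma dotBl p1 p2 q : dot (p1 - p2) q = dot p1 q - dot p2 q.
Proof. by rewrite dotDl -scaleN1r dotZl mulN1r. Qed.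

Lemma dot0r p : dot p 0 = 0.
Proof. by rewrite dotC dot0l rmorph0. Qed.

Lemma dotDr p q1 q2 : dot p (q1 + q2) = dot p q1 + dot p q2.
Proof. by rewrite !(dotC _ p) dotDl rmorphD. Qed.

Lemma dotZr c p q : dot p (c *: q) = c^* * dot p q.
Proof. by rewrite !(dotC _ p) dotZl rmorphM. Qed.

Lemma dotBr p q1 q2 : dot p (q1 - q2) = dot p q1 - dot p q2.
Proof. by rewrite dotDr -scaleN1r dotZr rmorphN1 mulN1r. Qed.

Lemma dot_suml I r (Q : pred I) (F : I -> A) q :
  dot (\sum_(i <- r | Q i) F i) q = \sum_(i <- r | Q i) dot (F i) q.
Proof. exact: (big_morph (dot^~ q) (fun p1 p2 => dotDl p1 p2 q) (dot0l q)). Qed.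

Lemma dot_sumr I r (Q : pred I) (F : I -> A) p :
  dot p (\sum_(i <- r | Q i) F i) = \sum_(i <- r | Q i) dot p (F i).
Proof. exact: (big_morph (dot p) (dotDr p) (dot0r p)). Qed.

Lemma dot_mon p w : dot p (mon w) = coef p w.
Proof.
pose d := (FMonom w |` msupp p)%fset.
rewrite (@dotEw d) ?fsubsetUr// (big_fsetD1 (FMonom w)) ?fset1U1//=.
rewrite coef_mon eqxx conjC1 mulr1 big_seq big1 ?addr0// => -[u].
rewrite in_fsetD1 coef_mon => /andP[uw _].
by rewrite eq_sym -val_eqE/= in uw; rewrite (negbTE uw) conjC0 mulr0.
Qed.

Lemma dot_monl w p : dot (mon w) p = (coef p w)^*.
Proof. by rewrite dotC dot_mon. Qed.

Lemma dot_ge0 p : 0 <= dot p p.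
Proof. by apply: sumr_ge0 => w _; rewrite mul_conjC_ge0. Qed.

Lemma dot_eq0 p : dot p p = 0 -> p = 0.
Proof.
move=> /eqP; rewrite /dot psumr_eq0 => [/allP h|w _]; last by rewrite mul_conjC_ge0.
apply/coefP => w; rewrite coef0; have [//|] := eqVneq (coef p w) 0.
by rewrite {1}/coef mcoeff_neq0 => /h /=; rewrite mul_conjC_eq0 => /eqP.
Qed.

Lemma scale_mon (c : C) u (k : fmonom 'I_m) :
  k = u :> seq 'I_m -> mkmalgU k c = c *: mon u.
Proof.
move=> ku; apply/coefP => v.
by rewrite coefZ_mon /coef mcoeffU -val_eqE/= ku; case: eqP.
Qed.

Lemma monM w p : mon w * p = \sum_(u <- msupp p) coef p u *: mon (w ++ u).
Proof.
rewrite malgM_def fgmulUg; apply: eq_bigr => u _; rewrite mul1r.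
by case: u => u; apply: scale_mon; rewrite fmM.
Qed.

Lemma Mmon w p : p * mon w = \sum_(u <- msupp p) coef p u *: mon (u ++ w).
Proof.
rewrite malgM_def fgmulgU; apply: eq_bigr => u _; rewrite mulr1.
by case: u => u; apply: scale_mon; rewrite fmM.
Qed.

Lemma dot_monM w p q : dot (mon w * p) (mon w * q) = dot p q.
Proof.
rewrite !monM [in RHS](ncpolyE p) [in RHS](ncpolyE q).
rewrite [LHS]dot_suml [RHS]dot_suml; apply: eq_bigr => u _.
rewrite [LHS]dot_sumr [RHS]dot_sumr; apply: eq_bigr => v _.
rewrite [LHS]dotZl [RHS]dotZl [X in _ * X = _]dotZr [X in _ = _ * X]dotZr.
by rewrite 2!dot_mon 2!coef_mon eqseq_cat// eqxx.
Qed.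

Lemma proj_ex (ws : seq (seq 'I_m)) (W : set A) :
  W 0 -> (forall c p q, W p -> W q -> W (c *: p + q)) ->
  (forall p w, W p -> coef p w != 0 -> w \in ws) ->
  forall p, exists h, W h /\ forall g, W g -> dot (p - h) g = 0.
Proof.
elim: ws W => [|x ws IH] W W0 Wlin Wws p.
  exists 0; split=> // g Wg; suff -> : g = 0 by rewrite dot0r.
  apply/coefP => w; rewrite coef0; apply/eqP/negPn/negP => /(Wws _ _ Wg).
  by rewrite in_nil.
pose W' : set A := [set g | W g /\ coef g x = 0].
have {}IH : forall p, exists h, W' h /\ forall g, W' g -> dot (p - h) g = 0.
  apply: IH.
  - by split=> //; rewrite coef0.
  - move=> c a b [Wa a0] [Wb b0]; split; first exact: Wlin.
    by rewrite coefD coefZ a0 b0 mulr0 addr0.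
  - move=> g w [Wg gx] gw; have := Wws _ _ Wg gw; rewrite inE => /orP[/eqP wx|//].
    by rewrite wx gx eqxx in gw.
have WB a b : W a -> W b -> W (a - b).
  by move=> Wa Wb; rewrite addrC -scaleN1r; exact: Wlin.
have [hp [[Whp hpx] hpP]] := IH p.
have [[w0 [Ww0 w0x]]|nW] := pselect (exists w0 : A, W w0 /\ coef w0 x != 0); last first.
  exists hp; split=> // g Wg; apply: hpP; split=> //.
  by apply/eqP/negPn/negP => gx; apply: nW; exists g.
pose w1 := (coef w0 x)^-1 *: w0.
have Ww1 : W w1 by rewrite -[w1]addr0; exact: Wlin.
have [h1 [[Wh1 h1x] h1P]] := IH w1; pose v := w1 - h1.
have vx : coef v x = 1 by rewrite coefB h1x subr0 coefZ mulVf.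
have Wv : W v by exact: WB.
have vv0 : dot v v != 0.
  by apply/eqP => /dot_eq0 v0; move: vx; rewrite v0 coef0 => /eqP; rewrite eq_sym oner_eq0.
pose c := dot p v / dot v v.
exists (c *: v + hp); split; first exact: Wlin.
move=> g Wg; pose g' := g - coef g x *: v.
have Wg' : W' g'.
  split; last by rewrite coefB coefZ vx mulr1 subrr.
  by rewrite /g' addrC -scaleNr; exact: Wlin.
have -> : g = g' + coef g x *: v by rewrite subrK.
rewrite opprD addrCA addrC dotDl dotDr (hpP _ Wg') add0r -scaleNr dotZl dotDr.
rewrite [dot v g']h1P// add0r !dotZr dotBl.
have -> : dot hp v = 0 by rewrite dotC h1P ?conjC0.
rewrite subr0 mulrCA -mulrDr /c mulNr divfK// subrr mulr0 //.
Qed.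

Lemma tpow_lin n c p q : tpow n p -> tpow n q -> tpow n (c *: p + q).
Proof.
move=> np nq w; rewrite coefD coefZ; have [->|/np//] := eqVneq (coef p w) 0.
by rewrite mulr0 add0r => /nq.
Qed.

Lemma tpow0 n : tpow n 0.
Proof. by move=> w; rewrite coef0 eqxx. Qed.

Lemma tpow_mon w : tpow (size w) (mon w).
Proof. by move=> u; rewrite coef_mon pnatr_eq0 eqb0 negbK => /eqP ->. Qed.

Lemma tpowM n k p q : tpow n p -> tpow k q -> tpow (n + k) (p * q).
Proof.
move=> np kq w; rewrite /coef mcoeff_neq0 => /msuppM_le[u [v [up vq uv]]].
have -> : w = u ++ v :> seq _ by rewrite -fmM -uv.
rewrite size_cat; congr addn.
  by apply: np; case: u up {uv} => u; rewrite /coef mcoeff_neq0.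
by apply: kq; case: v vq {uv} => v; rewrite /coef mcoeff_neq0.
Qed.

End NCPoly.

Section Subproduct.
Context {C : numClosedFieldType} {m : nat} (P : ncpoly C m).
Local Notation A := (ncpoly C m).

Definition ideal : set A :=
  [set p | exists (N : nat) (b c : 'I_N -> A), p = \sum_(k < N) b k * P * c k].

Definition ideal_deg n : set A := ideal `&` tpow n.

Definition in_Hn n : {pred A} :=
  fun h => `[< tpow n h /\ forall p, ideal_deg n p -> dot h p = 0 >].

Lemma in_HnP n h :
  reflect (tpow n h /\ forall p, ideal_deg n p -> dot h p = 0) (h \in in_Hn n).
Proof. exact: asboolP. Qed.

Lemma in_Hn_submod n : submod_closed (in_Hn n).
Proof.
split=> [|c p q /in_HnP[np pP] /in_HnP[nq qP]]; apply/in_HnP; split.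
- exact: tpow0.
- by move=> p _; rewrite dot0l.
- exact: tpow_lin.
- by move=> g gI; rewrite dotPl pP// qP// mulr0 addr0.
Qed.

HB.instance Definition _ n :=
  GRing.isSubmodClosed.Build C A (in_Hn n) (in_Hn_submod n).

(* The Hilbert space H_n = I_n^\perp inside H^{(x) n}. *)
Record Hn n := MkHn { Hn_val :> A ; Hn_valP : Hn_val \in in_Hn n }.

HB.instance Definition _ n := [isSub for @Hn_val n].
HB.instance Definition _ n := [Choice of Hn n by <:].
HB.instance Definition _ n := [SubChoice_isSubLmodule of Hn n by <:].

Lemma proj_Hn_ex n (p : A) :
  exists h : Hn n, forall g : Hn n, dot (p - Hn_val h) g = 0.
Proof.
have [|||h [hH hP]] := @proj_ex _ _ [seq tval t | t : n.-tuple 'I_m]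
    [set h | h \in in_Hn n] _ _ _ p.
- exact: (in_Hn_submod n).1.
- by move=> c g h gH hH; apply: (in_Hn_submod n).2.
- move=> h w /in_HnP[nh _] /nh/eqP sw.
  by apply/mapP; exists (Tuple sw); rewrite ?mem_enum.
- by exists (MkHn hH) => -[g gH]; apply: hP.
Qed.

(* The orthogonal projection onto H_n, defined on the whole of T(C^m). *)
Definition proj_Hn n (p : A) : Hn n := projT1 (cid (proj_Hn_ex n p)).

Lemma proj_HnP n (p : A) (g : Hn n) :
  dot (p - Hn_val (proj_Hn n p)) g = 0.
Proof. exact: (projT2 (cid (proj_Hn_ex n p))). Qed.

Lemma dot_proj n (p : A) : dot (proj_Hn n p) (proj_Hn n p) <= dot p p.
Proof.
have := proj_HnP p (proj_Hn n p); move: (proj_Hn n p) => [h /= _] hp.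
rewrite -{1 2}[p](subrK h); move: (p - h) hp => d dh.
by rewrite dotDl !dotDr dh [dot h d]dotC dh conjC0 addr0 add0r lerDr dot_ge0.
Qed.

(* For z homogeneous of degree n + k, z is the sum of slice n v z * mon v over
   the words v of length k; if z is in H_{n+k}, then every slice lies in H_n. *)
Definition slice n (v : seq 'I_m) (z : A) : A :=
  \sum_(u : n.-tuple 'I_m) coef z (u ++ v) *: mon u.

Lemma coef_slice n v z u :
  coef (slice n v z) u = if size u == n then coef z (u ++ v) else 0.
Proof.
rewrite coef_sum; under eq_bigr do rewrite coefZ_mon.
case: ifPn => [su|su].
  rewrite (bigD1 (Tuple su))//= eqxx big1 ?addr0// => t tu.
  by rewrite ifF//; apply: contra_neqF tu => /eqP tu; apply/val_inj.
rewrite big1// => t _; rewrite ifF//.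
by apply: contraNF su => /eqP <-; rewrite size_tuple.
Qed.

Lemma slice_subproof n k (z : Hn (n + k)) (v : k.-tuple 'I_m) :
  slice n v z \in in_Hn n.
Proof.
case: z => z /= /in_HnP[nz zP]; apply/in_HnP; split.
  by move=> u; rewrite coef_slice; case: ifP => [/eqP//|_]; rewrite eqxx.
move=> p [[N [b [c pE]]] np].
have -> : dot (slice n v z) p = dot z (p * mon v).
  rewrite (Mmon v p) [X in dot _ X = _](ncpolyE p) [LHS]dot_sumr [RHS]dot_sumr.
  rewrite [LHS]big_seq [RHS]big_seq; apply: eq_bigr => -[w] wp.
  rewrite [LHS]dotZr [RHS]dotZr [X in _ * X = _]dot_mon [X in _ = _ * X]dot_mon.
  by rewrite coef_slice (_ : size w == n)//; apply/eqP/np; rewrite /coef mcoeff_neq0.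
apply: zP; split; last first.
  by apply: tpowM => //; rewrite -{1}(size_tuple v); exact: tpow_mon.
exists N, b, (fun i => c i * mon v); rewrite pE mulr_suml.
by apply: eq_bigr => i _; rewrite -[LHS]mulrA.
Qed.

Definition Hn_slice n k (z : Hn (n + k)) (v : k.-tuple 'I_m) : Hn n :=
  MkHn (slice_subproof z v).

(* f_{n+k} (T (x) 1) f_{n+k}: on z = sum_v z_v X_v with z_v in H_n, the operator
   T (x) 1 gives sum_v T(z_v) X_v. *)
Definition psi n k (T : Hn n -> Hn n) (z : Hn (n + k)) : Hn (n + k) :=
  proj_Hn (n + k) (\sum_(v : k.-tuple 'I_m) Hn_val (T (Hn_slice z v)) * mon v).

End Subproduct.

Section Series.
Context {R : realType}.
Implicit Types u v : R^nat.

Lemma is_cvg_seriesP r u v : cvgn (series u) -> cvgn (series v) ->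
  cvgn (series (fun n => 2 * (r * u n + v n))).
Proof.
move=> cu cv; rewrite (_ : (fun n => _) = 2 *: ((r *: u) + v))//.
by apply: is_cvg_seriesZ; apply: is_cvg_seriesD => //; exact: is_cvg_seriesZ.
Qed.

Lemma is_cvg_series_shift u :
  cvgn (series (fun n => u n.+1)) -> cvgn (series u).
Proof.
move=> /cvg_ex[l cu]; apply/cvg_ex; exists (u 0%N + l); rewrite -cvg_shiftS.
rewrite (_ : [sequence _]_n = cst (u 0%N) + series (fun n => u n.+1)).
  by apply: cvgD => //; exact: cvg_cst.
by apply/funext => n; rewrite /series/= big_nat_recl.
Qed.

Lemma is_cvg_series1 u n : (forall k, k != n -> u k = 0) -> cvgn (series u).
Proof.
move=> u0; apply/cvg_ex; exists (u n); apply: cvg_near_cst.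
near=> N; rewrite /series/= (bigD1_seq n) ?iota_uniq//=; last first.
  by rewrite mem_index_iota; near: N; exact: nbhs_infty_gt.
by rewrite big1 ?addr0// => i /u0.
Unshelve. all: by end_near. Qed.

End Series.

Section NormSq.
Context {R : realType} {m : nat}.
Local Notation C := (cplx R).
Implicit Types p q : ncpoly C m.

Definition nsq p : R := complex.Re (dot p p).

Lemma nsqE p : (nsq p)%:C%C = dot p p.
Proof. by rewrite /nsq RRe_real// ger0_real// dot_ge0. Qed.

Lemma nsq_ge0 p : 0 <= nsq p.
Proof. by rewrite -ler0c nsqE dot_ge0. Qed.

Lemma nsq0 : nsq 0 = 0.
Proof. by rewrite /nsq dot0l. Qed.

Lemma nsqD_le p q : nsq (p + q) <= 2 * (nsq p + nsq q).
Proof.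
rewrite mulr_natl -lecR rmorphMn/= rmorphD/= !nsqE -subr_ge0 -mulr_natl.
suff -> : 2 * (dot p p + dot q q) - dot (p + q) (p + q) = dot (p - q) (p - q).
  exact: dot_ge0.
by rewrite !(dotBl, dotBr, dotDl, dotDr); ring.
Qed.

Lemma nsqZ (c : C) p : nsq (c *: p) = complex.Re (`|c| ^+ 2) * nsq p.
Proof.
have : (complex.Re (`|c| ^+ 2))%:C%C = `|c| ^+ 2 :> C.
  by apply: RRe_real; rewrite realX// normr_real.
move: (complex.Re _) => r rE; apply: complexI.
by rewrite rmorphM/= !nsqE rE dotZl dotZr mulrA -normCK.
Qed.

Lemma nsqP_le (c : C) p q :
  nsq (c *: p + q) <= 2 * (complex.Re (`|c| ^+ 2) * nsq p + nsq q).
Proof. by rewrite -nsqZ; exact: nsqD_le. Qed.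

Lemma Re_norm2_ge0 (c : C) : 0 <= complex.Re (`|c| ^+ 2).
Proof. by have : 0 <= `|c| ^+ 2 by []; rewrite lecE => /andP[]. Qed.

Lemma nsq_proj P n p : nsq (proj_Hn P n p) <= nsq p.
Proof. by rewrite -lecR !nsqE dot_proj. Qed.

Lemma nsq_monM w p : nsq (mon w * p) = nsq p.
Proof. by rewrite /nsq dot_monM. Qed.

End NormSq.

Section Fock.
Context {R : realType} {m : nat} (P : ncpoly (cplx R) m).
Local Notation C := (cplx R).
Local Notation A := (ncpoly C m).
Local Notation Hn := (Hn P).

(* The Fock space: l^2-sequences x with x n in H_n. *)
Definition in_fock : {pred (nat -> A)} :=
  fun x => `[< (forall n, x n \in in_Hn P n) /\ cvgn (series (fun n => nsq (x n))) >].

Lemma in_fockP x :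
  reflect ((forall n, x n \in in_Hn P n) /\ cvgn (series (fun n => nsq (x n))))
          (x \in in_fock).
Proof. exact: asboolP. Qed.

Lemma in_fock_submod : submod_closed in_fock.
Proof.
split=> [|c x y /in_fockP[xH xs] /in_fockP[yH ys]]; apply/in_fockP; split.
- by move=> n; exact: (in_Hn_submod P n).1.
- rewrite (_ : (fun n => _) = fun=> 0); last by apply/funext => n; exact: nsq0.
  rewrite (_ : series _ = fun=> 0); first exact: is_cvg_cst.
  by apply/funext => n; rewrite /series/= big1.
- by move=> n; apply: (in_Hn_submod P n).2.
- apply: (@series_le_cvg _ _
    (fun n => 2 * (complex.Re (`|c| ^+ 2) * nsq (x n) + nsq (y n)))).
  + by move=> n; exact: nsq_ge0.
  + move=> n; apply: mulr_ge0 => //; apply: addr_ge0; last exact: nsq_ge0.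
    by apply: mulr_ge0; [exact: Re_norm2_ge0|exact: nsq_ge0].
  + by move=> n; exact: nsqP_le.
  + exact: is_cvg_seriesP.
Qed.

HB.instance Definition _ :=
  GRing.isSubmodClosed.Build C (nat -> A) in_fock in_fock_submod.

Record fock := MkFock { fock_val :> nat -> A ; fock_valP : fock_val \in in_fock }.

HB.instance Definition _ := [isSub for fock_val].
HB.instance Definition _ := [Choice of fock by <:].
HB.instance Definition _ := [SubChoice_isSubLmodule of fock by <:].

Definition fdot (x y : fock) : C := limn (series (fun n => dot (x n) (y n))).

Definition fnorm (x : fock) : R :=
  Num.sqrt (limn (series (fun n => nsq (x n)))).

Lemma fock_Hn (x : fock) n : x n \in in_Hn P n.
Proof. by have /in_fockP[] := fock_valP x. Qed.

Definition fock_comp n (x : fock) : Hn n := MkHn (fock_Hn x n).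

Lemma fock_emb_subproof n (h : Hn n) :
  (fun k => if k == n then Hn_val h else 0) \in in_fock.
Proof.
apply/in_fockP; split=> [k|].
  by case: eqP => [->|_]; [exact: Hn_valP|exact: (in_Hn_submod P k).1].
by apply: (@is_cvg_series1 _ _ n) => k /negbTE ->; exact: nsq0.
Qed.

Definition fock_emb n (h : Hn n) : fock := MkFock (fock_emb_subproof h).

Lemma creation_subproof (i : 'I_m) (x : fock) :
  (fun n => if n is k.+1 then Hn_val (proj_Hn P k.+1 (mon [:: i] * x k)) else 0)
    \in in_fock.
Proof.
have /in_fockP[xH xs] := fock_valP x; apply/in_fockP; split=> [[|n]|].
- exact: (in_Hn_submod P 0).1.
- exact: Hn_valP.
apply: is_cvg_series_shift; apply: (@series_le_cvg _ _ (fun n => nsq (x n))) => // n.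
- exact: nsq_ge0.
- exact: nsq_ge0.
- by rewrite -(nsq_monM [:: i] (x n)); exact: nsq_proj.
Qed.

Definition creation (i : 'I_m) (x : fock) : fock := MkFock (creation_subproof i x).

Definition bounded_by (T : fock -> fock) (M : R) :=
  0 <= M /\ forall x, fnorm (T x) <= M * fnorm x.

(* B(F_P) *)
Definition bop : set (fock -> fock) :=
  [set T | linear T /\ exists M, bounded_by T M].

Definition opnorm (T : fock -> fock) : R := inf [set M | bounded_by T M].

Definition adjoint (T T' : fock -> fock) :=
  forall x y, fdot (T x) y = fdot x (T' y).

Definition norm_closure (B : set (fock -> fock)) : set (fock -> fock) :=
  [set T | bop T /\ forall e : R, 0 < e -> exists2 U, B U & opnorm (T \- U) < e].

Definition unital_cstar_subalgebra (B : set (fock -> fock)) :=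
  [/\ B `<=` bop, B idfun,
      forall (c : C) T U, B T -> B U -> B (fun x => c *: T x + U x),
      forall T U, B T -> B U -> B (T \o U)
    & (forall T T', B T -> bop T' -> adjoint T T' -> B T')
      /\ norm_closure B `<=` B].

Definition toeplitz : set (fock -> fock) :=
  [set T | forall B, unital_cstar_subalgebra B ->
     (forall i, B (creation i)) -> B T].

Lemma gauge_subproof (z : C) (x : fock) : `|z| = 1 ->
  (fun n => z ^+ n *: x n) \in in_fock.
Proof.
have /in_fockP[xH xs] := fock_valP x; move=> z1; apply/in_fockP; split=> [n|].
  by rewrite -[_ *: _]addr0; apply: (in_Hn_submod P n).2; [|exact: (in_Hn_submod P n).1].
rewrite (_ : (fun n => _) = (fun n => nsq (x n)))//; apply/funext => n.
by rewrite nsqZ normrX z1 !expr1n mul1r.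
Qed.

Definition gauge (z : C) (z1 : `|z| = 1) (x : fock) : fock :=
  MkFock (gauge_subproof x z1).

Lemma norm1V (z : C) : `|z| = 1 -> `|z^-1| = 1.
Proof. by move=> z1; rewrite normfV z1 invr1. Qed.

Definition gauge_action (z : C) (z1 : `|z| = 1) (T : fock -> fock) :=
  gauge z1 \o T \o gauge (norm1V z1).

Definition toeplitz0 : set (fock -> fock) :=
  [set T | toeplitz T /\ forall z (z1 : `|z| = 1), gauge_action z1 T = T].

(* The l^oo-direct sum of the B(H_n), as the bounded operators on the Fock space
   that preserve each H_n. *)
Definition linfty : set (fock -> fock) :=
  [set T | bop T /\ forall n (h : Hn n), exists g : Hn n, T (fock_emb h) = fock_emb g].

Definition component (T : fock -> fock) n (h : Hn n) : Hn n :=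
  fock_comp n (T (fock_emb h)).

Definition Cbar : set (fock -> fock) :=
  norm_closure [set T | linfty T /\ exists N, forall n k, (N <= n)%N ->
    psi (component T (n:=n)) = component T (n:=n + k)].

End Fock.

Arguments toeplitz {R m} P _.
Arguments toeplitz0 {R m} P _.
Arguments linfty {R m} P _.
Arguments Cbar {R m} P _.

(* sum_i a_i X_i X_{m-i+1}; as 'I_m is 0-based, m-i+1 becomes rev_ord i. *)
Definition quadratic {R : realType} {m : nat} (a : 'I_m -> cplx R) :
  ncpoly (cplx R) m := \sum_(i < m) a i *: (mon [:: i] * mon [:: rev_ord i]).

(* Main.v *)
Require Import Defs.
From HB Require Import structures.
From mathcomp Require Import all_boot all_order all_algebra finmap.
From mathcomp Require Import all_classical all_reals all_analysis.
From mathcomp Require Import complex ring lra.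
From mathcomp Require monalg.
Import -(notations) monalg.
Import Defs.

Set Implicit Arguments.
Unset Strict Implicit.
Unset Printing Implicit Defensive.

Import Order.TTheory GRing.Theory Num.Theory.
Import numFieldNormedType.Exports.
Local Open Scope classical_set_scope.
Local Open Scope ring_scope.

(** Write i' for the index reversed to i, d for the sum of the |a_i|^2, and A_i for
    the adjoint of S_i, which removes a leading letter X_i. Wenzl's recursion
    expresses f_{n+1}(X_j h), for h in H_n, through f_n, and yields on H_n
      A_i S_j = delta_ij - c_n a_i conj(a_j) S_{i'} A_{j'},
    where c_0 = 0 and c_{n+1} = 1/(d - c_n). As the sequence c converges, the
    operators S_u D A_v, with D multiplying each H_n by the n-th term of a
    convergent sequence, span a *-algebra; its norm closure contains T_P. If T in
    T_P is gauge invariant, then in an approximation of T by sums of such operators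
    the terms with |u| <> |v| can be dropped without increasing the error. When
    |u| = |v| and D is eventually constant, S_u D A_v is eventually compatible with
    the maps psi, by the very definition of psi; hence T is in C(FO_P).
    Conversely, an x with psi_{N,N+k}(x_N) = x_{N+k} for all k is the sum of a
    combination of the S_u A_v with |u| = |v| = N, given by the matrix of x_N, and
    of combinations of the S_u e_0 A_v with |u| = |v| < N, where the vacuum
    projection e_0 = 1 - sum_i S_i A_i is in T_P. *)

(** * Left multiplication by words and its adjoint *)

(* Without the locks, a failing unification unfolds the convolution product. *)
HB.lock Definition lmul {C : numClosedFieldType} {m : nat} (u : seq 'I_m)
  (p : ncpoly C m) : ncpoly C m := mon u * p.

(** The adjoint of left multiplication by [mon J], as [dot_lmul] shows; its restriction to the H_n
    is the annihilation of a word. *)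
HB.lock Definition lshift_by {C : numClosedFieldType} {m : nat} (J : seq 'I_m)
  (z : ncpoly C m) : ncpoly C m :=
  \sum_(w <- msupp z | prefix J w) coef z w *: mon (drop (size J) w).

Section NCPolyTheory.
Context {C : numClosedFieldType} {m : nat}.
Local Notation A := (ncpoly C m).
Implicit Types (p q z : A) (u v w J : seq 'I_m).

Lemma coef_lshift J z u : coef (lshift_by J z) u = coef z (J ++ u).
Proof.
rewrite lshift_by.unlock coef_sum -(dot_mon z) /dot big_mkcond; apply: eq_bigr => w _.
rewrite coefZ_mon coef_mon conjC_nat.
have -> : (J ++ u == w) = prefix J w && (drop (size J) w == u).
  apply/eqP/andP => [<-|[/prefixP[v ->] /eqP <-]].
    by rewrite prefix_prefix drop_size_cat.
  by rewrite drop_size_cat.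
by case: prefix; case: eqP; rewrite (mulr0, mulr1).
Qed.

Lemma lshift_lin J c p q :
  lshift_by J (c *: p + q) = c *: lshift_by J p + lshift_by J q.
Proof. by apply/coefP => w; rewrite !(coefD, coefZ, coef_lshift). Qed.

Lemma lshift_by0 J : lshift_by J (0 : A) = 0.
Proof. by apply/coefP => w; rewrite coef_lshift !coef0. Qed.

Lemma lshift_cat u v z : lshift_by (u ++ v) z = lshift_by v (lshift_by u z).
Proof. by apply/coefP => w; rewrite !coef_lshift catA. Qed.

Lemma lshift_nil z : lshift_by [::] z = z.
Proof. by apply/coefP => w; rewrite coef_lshift. Qed.

Lemma dot_lmul J p q : dot (lmul J p) q = dot p (lshift_by J q).
Proof.
rewrite lmul.unlock monM [LHS]dot_suml /dot; apply: eq_bigr => u _.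
by rewrite [LHS]dotZl dot_monl coef_lshift.
Qed.

Lemma coef_lmul J p w :
  coef (lmul J p) w = if prefix J w then coef p (drop (size J) w) else 0.
Proof.
rewrite -dot_mon dot_lmul; case: ifP => [/prefixP[u ->]|nJ].
  rewrite -dot_mon drop_size_cat//; congr dot; apply/coefP => v.
  by rewrite coef_lshift !coef_mon eqseq_cat// eqxx.
rewrite -[RHS](dot0r p); congr dot; apply/coefP => v.
rewrite coef_lshift coef_mon coef0; case: eqP => // e.
by rewrite e prefix_prefix in nJ.
Qed.

Lemma lmul_lin J c p q : lmul J (c *: p + q) = c *: lmul J p + lmul J q.
Proof.
apply/coefP => w; rewrite coefD coefZ !coef_lmul coefD coefZ.
by case: ifP; rewrite ?mulr0 ?addr0.
Qed.

Lemma lmul0 J : lmul J (0 : A) = 0.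
Proof. by apply/coefP => w; rewrite coef_lmul !coef0 if_same. Qed.

Lemma lshift1_lmul i j p :
  lshift_by [:: i] (lmul [:: j] p) = (i == j)%:R *: p.
Proof.
apply/coefP => w; rewrite coef_lshift coef_lmul coefZ /= eq_sym prefix0s andbT drop0.
by case: eqP => _; rewrite (mul1r, mul0r).
Qed.

Lemma mon_cat u v : mon u * mon v = mon (u ++ v) :> A.
Proof.
have -> : mon u * mon v = lmul u (mon v) :> A by rewrite lmul.unlock.
apply/coefP => w; rewrite -dot_mon dot_lmul dot_monl coef_lshift !coef_mon.
by rewrite conjC_nat eq_sym.
Qed.

Lemma mulZr c p q : p * (c *: q) = c *: (p * q).
Proof.
rewrite (ncpolyE p) !mulr_suml scaler_sumr; apply: eq_bigr => u _.
rewrite -!scalerAl !scalerA mulrC -scalerA; congr (_ *: _).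
have lmulE p1 : mon u * p1 = lmul u p1 by rewrite lmul.unlock.
by rewrite !lmulE -[c *: q]addr0 lmul_lin lmul0 addr0.
Qed.

Lemma mul_monl_expand p q : p * q = \sum_(u <- msupp p) coef p u *: (mon u * q).
Proof.
rewrite {1}(ncpolyE p) [LHS]mulr_suml; apply: eq_bigr => u _.
by rewrite -scalerAl.
Qed.

Lemma mul_monr_expand p q : p * q = \sum_(u <- msupp q) coef q u *: (p * mon u).
Proof.
by rewrite {1}(ncpolyE q) [LHS]mulr_sumr; apply: eq_bigr => u _; rewrite mulZr.
Qed.

Lemma tpow_lshift n J z : tpow (size J + n) z -> tpow n (lshift_by J z).
Proof.
by move=> tz w; rewrite coef_lshift => /tz; rewrite size_cat => /addnI.
Qed.

Lemma tpow0_lshift i z : tpow 0 z -> lshift_by [:: i] z = 0.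
Proof.
move=> tz; apply/coefP => w; rewrite coef_lshift coef0; apply/eqP/negPn/negP.
by move=> /tz.
Qed.

Lemma tpow_size n z w : tpow n z -> size w != n -> coef z w = 0.
Proof. by move=> tz; apply: contraNeq => /tz ->. Qed.

Lemma lshift_expand n z : tpow n.+1 z ->
  z = \sum_i lmul [:: i] (lshift_by [:: i] z).
Proof.
move=> tz; apply/coefP => w; rewrite coef_sum.
case: w => [|j w].
  rewrite (tpow_size tz)// big1// => i _.
  by rewrite coef_lmul.
rewrite (bigD1 j)//= coef_lmul /= eqxx prefix0s/= drop0 coef_lshift.
rewrite big1 ?addr0// => i /negbTE ij; rewrite coef_lmul/= ij//.
Qed.

Lemma dot_tuple n p q : tpow n p ->
  dot p q = \sum_(w : n.-tuple 'I_m) coef p w * (coef q w)^*.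
Proof.
move=> tp; rewrite {1}/dot.
(* Slicing off the empty word cuts [q] down to its degree n part, written as a sum over words of
   length n; the sum over the support of [p] then becomes a sum over tuples. *)
transitivity (dot p (slice n [::] q)).
  rewrite /dot [LHS]big_seq [RHS]big_seq; apply: eq_bigr => -[w] wp.
  have sw : size w = n by apply: tp; rewrite /coef mcoeff_neq0.
  by rewrite (coef_slice n [::] q w) sw eqxx cats0.
rewrite /slice dot_sumr; apply: eq_bigr => w _.
by rewrite dotZr mulrC dot_mon cats0.
Qed.

Lemma coef_slice_tuple z n (u : n.-tuple 'I_m) v :
  coef (slice n v z) u = coef z (u ++ v).
Proof. by rewrite coef_slice size_tuple eqxx. Qed.

(** This is the isometry of H^{(x)(n+k)} with H^{(x)n} (x) H^{(x)k}: a word of length n + k is a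
    prefix of length n followed by a suffix of length k. *)
Lemma dot_slice n k p q : tpow (n + k) p ->
  dot p q = \sum_(v : k.-tuple 'I_m) dot (slice n v p) (slice n v q).
Proof.
move=> tp; rewrite (dot_tuple _ tp).
have ts (v : seq 'I_m) z : tpow n (slice n v z).
  by move=> w; rewrite coef_slice; case: ifP => [/eqP//|_]; rewrite eqxx.
transitivity (\sum_(v : k.-tuple 'I_m) \sum_(u : n.-tuple 'I_m)
    coef p (u ++ v) * (coef q (u ++ v))^*); last first.
  apply: eq_bigr => v _; rewrite (dot_tuple _ (ts _ _)); apply: eq_bigr => u _.
  by rewrite -(coef_slice_tuple p) -(coef_slice_tuple q).
rewrite exchange_big pair_big/=.
rewrite (reindex (fun uv : n.-tuple 'I_m * k.-tuple 'I_m => cat_tuple uv.1 uv.2))//=.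
exists (fun w : (n + k).-tuple 'I_m =>
  ([tuple tnth w (lshift k i) | i < n], [tuple tnth w (rshift n i) | i < k])).
  move=> [u v] _ /=; congr pair; apply: eq_from_tnth => i.
    by rewrite tnth_mktuple tnth_lshift.
  by rewrite tnth_mktuple tnth_rshift.
move=> w _ /=; apply: eq_from_tnth => i.
by case: (split_ordP i) => j ->; rewrite (tnth_lshift, tnth_rshift) tnth_mktuple.
Qed.

Lemma slice_lshift n J v z :
  slice n v (lshift_by J z) = lshift_by J (slice (size J + n) v z).
Proof.
apply/coefP => w; rewrite [RHS]coef_lshift [RHS]coef_slice [LHS]coef_slice.
by rewrite coef_lshift size_cat eqn_add2l catA.
Qed.

(** Slicing is the adjoint of right multiplication by a word. This moves the factor [mon v] in [psi]
    to the vector tested against. *)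
Lemma dot_Mmon n p v q : tpow n p -> dot (p * mon v) q = dot p (slice n v q).
Proof.
move=> tp; rewrite Mmon [LHS]dot_suml /dot big_seq [RHS]big_seq.
apply: eq_bigr => -[w] wp; rewrite [LHS]dotZl dot_monl coef_slice (tp w) ?eqxx//.
by rewrite /coef mcoeff_neq0.
Qed.

End NCPolyTheory.

(** * Orthogonal projections onto the spaces H_n *)

HB.lock Definition pj {C : numClosedFieldType} {m : nat} (P : ncpoly C m) n p :
  ncpoly C m := Hn_val (proj_Hn P n p).

Section Projections.
Context {C : numClosedFieldType} {m : nat} (P : ncpoly C m).
Local Notation A := (ncpoly C m).
Implicit Types (p q g h z : A).

Local Notation pj := (pj P).

Lemma pj_in n p : pj n p \in in_Hn P n.
Proof. by rewrite pj.unlock; exact: Hn_valP. Qed.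

Lemma in_Hn_lin n c p q :
  p \in in_Hn P n -> q \in in_Hn P n -> c *: p + q \in in_Hn P n.
Proof. exact: (in_Hn_submod P n).2. Qed.

Lemma in_Hn0 n : 0 \in in_Hn P n.
Proof. exact: (in_Hn_submod P n).1. Qed.

Lemma in_HnZ n c p : p \in in_Hn P n -> c *: p \in in_Hn P n.
Proof. by move=> pH; rewrite -[_ *: _]addr0 in_Hn_lin// in_Hn0. Qed.

Lemma in_HnB n p q : p \in in_Hn P n -> q \in in_Hn P n -> p - q \in in_Hn P n.
Proof. by move=> pH qH; rewrite addrC -scaleN1r in_Hn_lin. Qed.

Lemma in_Hn_tpow n p : p \in in_Hn P n -> tpow n p.
Proof. by case/in_HnP. Qed.

Lemma dot_pjl n p g : g \in in_Hn P n -> dot (pj n p) g = dot p g.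
Proof.
move=> gH; rewrite pj.unlock; have := proj_HnP p (MkHn gH); rewrite dotBl/= => /eqP.
by rewrite subr_eq0 => /eqP.
Qed.

(** Equalities in H_n are checked against test vectors of H_n, because there every outer projection
    f_n disappears by [dot_pjl]. *)
Lemma in_Hn_ext n p q : p \in in_Hn P n -> q \in in_Hn P n ->
  (forall g, g \in in_Hn P n -> dot p g = dot q g) -> p = q.
Proof.
move=> pH qH pq; apply/eqP; rewrite -subr_eq0; apply/eqP/dot_eq0.
by rewrite dotBl pq ?subrr// in_HnB.
Qed.

Lemma pj_uniq n p h : h \in in_Hn P n ->
  (forall g, g \in in_Hn P n -> dot p g = dot h g) -> pj n p = h.
Proof.
by move=> hH ph; apply: (@in_Hn_ext n) => // [|g gH]; rewrite ?pj_in// dot_pjl// ph.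
Qed.

Lemma pj_id n h : h \in in_Hn P n -> pj n h = h.
Proof. by move=> hH; apply: pj_uniq. Qed.

Lemma pj_lin n c p q : pj n (c *: p + q) = c *: pj n p + pj n q.
Proof.
apply: pj_uniq => [|g gH]; first by rewrite in_Hn_lin// pj_in.
by rewrite !dotPl !dot_pjl.
Qed.

Lemma pj0 n : pj n 0 = 0.
Proof. by apply: pj_id; exact: in_Hn0. Qed.

Lemma pjD n p q : pj n (p + q) = pj n p + pj n q.
Proof. by rewrite -[p]scale1r pj_lin !scale1r. Qed.

Lemma pjZ n c p : pj n (c *: p) = c *: pj n p.
Proof. by rewrite -[c *: p]addr0 pj_lin pj0 addr0. Qed.

Lemma pj_sum n I r (Q : pred I) (F : I -> A) :
  pj n (\sum_(i <- r | Q i) F i) = \sum_(i <- r | Q i) pj n (F i).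
Proof. exact: (big_morph (pj n) (pjD n) (pj0 n)). Qed.

Lemma slice_Hn n k (v : k.-tuple 'I_m) z :
  z \in in_Hn P (n + k) -> slice n v z \in in_Hn P n.
Proof. by move=> zH; exact: (slice_subproof (MkHn zH) v). Qed.

End Projections.

(** * The spaces H_n of a quadratic polynomial *)

Section Quadratic.
Context {R : realType} {m : nat} (a : 'I_m -> cplx R).
Local Notation A := (ncpoly (cplx R) m).
Local Notation P := (quadratic a).
Implicit Types (p q g h z : A).

Lemma dot_quadratic z u v : dot z (mon u * P * mon v) =
  \sum_i (a i)^* * coef z (u ++ i :: rev_ord i :: v).
Proof.
rewrite /quadratic mulr_sumr mulr_suml dot_sumr; apply: eq_bigr => i _.
by rewrite mulZr -scalerAl !mon_cat dotZr dot_mon -catA.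
Qed.

(** The products uPv with words u, v span the ideal, so orthogonality to I_n becomes one linear
    equation on coefficients for each pair (u, v). *)
Lemma in_Hn_quadratic n z : z \in in_Hn P n <-> tpow n z /\
  forall u v, \sum_i (a i)^* * coef z (u ++ i :: rev_ord i :: v) = 0.
Proof.
split=> [/in_HnP[tz zI]|[tz zE]]; [split=> // u v|apply/in_HnP; split=> //].
  have [e|ne] := eqVneq (size u + 2 + size v)%N n.
    rewrite -dot_quadratic; apply: zI; split.
      by exists 1%N, (fun=> mon u), (fun=> mon v); rewrite big_ord1.
    rewrite -e; apply: tpowM; last exact: tpow_mon.
    apply: tpowM; first exact: tpow_mon.
    rewrite /quadratic; elim/big_ind: _ => [|p q tp tq|i _]; first exact: tpow0.
      by rewrite -[p]scale1r; apply: tpow_lin.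
    rewrite -[X in tpow _ X]addr0; apply: tpow_lin; last exact: tpow0.
    by rewrite mon_cat; exact: tpow_mon.
  (* If uPv does not have degree n, homogeneity of [z] makes each coefficient vanish. *)
  rewrite big1// => i _; rewrite (tpow_size tz) ?mulr0//.
  by apply: contra ne => /eqP <-; rewrite size_cat/= -addnA.
move=> p [[N [b [c ->]]] _]; rewrite dot_sumr big1// => k _.
rewrite mul_monr_expand dot_sumr big1// => v _.
rewrite dotZr -mulrA mul_monl_expand dot_sumr big1 ?mulr0// => u _.
by rewrite dotZr mulrA dot_quadratic zE mulr0.
Qed.

Lemma in_Hn_lshift n i z : z \in in_Hn P n.+1 -> lshift_by [:: i] z \in in_Hn P n.
Proof.
move=> /in_Hn_quadratic[tz zE]; apply/in_Hn_quadratic; split.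
  exact: tpow_lshift.
by move=> u v; rewrite -[RHS](zE (i :: u) v); apply: eq_bigr => j _; rewrite coef_lshift.
Qed.

(** An inductive test for H_{n+1}: the equations for uPv with u nonempty are those of H_n for [z]
    without its first letter, and those with u empty are the last condition. *)
Lemma in_HnS n z : tpow n.+1 z ->
  (forall i, lshift_by [:: i] z \in in_Hn P n) ->
  \sum_i (a i)^* *: lshift_by [:: i; rev_ord i] z = 0 -> z \in in_Hn P n.+1.
Proof.
move=> tz zH zE; apply/in_Hn_quadratic; split=> // -[|j u] v.
  rewrite -[RHS](coef0 v) -zE coef_sum; apply: eq_bigr => i _.
  by rewrite coefZ coef_lshift.
have /in_Hn_quadratic[_ /(_ u v)] := zH j.
by under eq_bigr do rewrite coef_lshift.
Qed.

Lemma in_H0 z : tpow 0 z -> z \in in_Hn P 0.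
Proof.
move=> tz; apply/in_Hn_quadratic; split=> // u v; rewrite big1// => i _.
by rewrite (tpow_size tz) ?mulr0// size_cat addnS.
Qed.

Lemma in_H1 z : tpow 1 z -> z \in in_Hn P 1.
Proof.
move=> tz; apply: in_HnS => // [i|]; first by apply/in_H0/tpow_lshift.
rewrite big1// => i _; apply/coefP => w.
by rewrite coefZ coef_lshift coef0 (tpow_size tz) ?mulr0// size_cat.
Qed.

End Quadratic.

(** * Wenzl's recursion *)

(* Stated for an abstract module: in the monoid algebra, rewriting with scalerA can
   make conversion unfold the convolution product. *)
Section ScalarIdentities.
Context {K : comNzRingType} {V : lmodType K}.

Lemma scaler_nested (x b y w : K) (f e l : V) :
  x *: (b *: (y *: f + e) + w *: l) = (x * b) *: e + (x * b * y) *: f + (w * x) *: l.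
Proof.
by rewrite !scalerDr !scalerA [x * w]mulrC; congr (_ + _); rewrite addrC.
Qed.

Lemma sum_scaler_delta m (b : 'I_m -> K) y j (x : 'I_m -> K) (e : V) (f l : 'I_m -> V) :
  \sum_i (b i *: e + y *: f i + ((i == j)%:R * x i) *: l i) =
  (\sum_i b i) *: e + y *: (\sum_i f i) + x j *: l j.
Proof.
rewrite !big_split /= scaler_suml scaler_sumr; congr (_ + _).
rewrite (bigD1 j)//= eqxx mul1r big1 ?addr0// => i /negbTE ->.
by rewrite mul0r scale0r.
Qed.

Lemma scaler_eq0_sum (x y z : K) (e : V) : x + y + z = 0 -> x *: e + y *: e + z *: e = 0.
Proof. by rewrite -!scalerDl => ->; rewrite scale0r. Qed.

Lemma scaler_eqNM (x y : K) (u v : V) : y *: u = y *: v -> - (x * y) *: u = - (x * y) *: v.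
Proof. by move=> uv; rewrite -mulNr -!scalerA uv. Qed.

Lemma scaler_reassoc (x y z : K) (u v : V) :
  - (x * y) * z *: u + v = - (y * z) *: (x *: u) + v.
Proof. by rewrite scalerA mulNr mulNr -mulrA [y * z * x]mulrC. Qed.

End ScalarIdentities.

Section Wenzl.
Context {R : realType} {m : nat} (a : 'I_m -> cplx R).
Local Notation A := (ncpoly (cplx R) m).
Local Notation P := (quadratic a).
Implicit Types (p q g h z : A).

Lemma lshift_quadratic n z : z \in in_Hn P n ->
  \sum_i (a i)^* *: lshift_by [:: i; rev_ord i] z = 0.
Proof.
move=> /in_Hn_quadratic[_ zE]; apply/coefP => w; rewrite coef_sum coef0.
by rewrite -[RHS](zE [::] w); apply: eq_bigr => i _; rewrite coefZ coef_lshift.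
Qed.

Lemma tpow_lmul n i p : tpow n p -> tpow n.+1 (lmul [:: i] p).
Proof.
move=> tp; rewrite lmul.unlock -add1n; apply: tpowM => //.
exact: (@tpow_mon _ _ [:: i]).
Qed.

Lemma tpowZ n b p : tpow n p -> tpow n (b *: p : A).
Proof. by move=> tp; rewrite -[_ *: p]addr0; apply: tpow_lin => //; exact: tpow0. Qed.

Lemma tpow_sum n (F : 'I_m -> A) : (forall i, tpow n (F i)) -> tpow n (\sum_i F i).
Proof.
move=> tF; elim/big_ind: _ => [|p q tp tq|i _]; [exact: tpow0| |exact: tF].
by rewrite -[p]scale1r; exact: tpow_lin.
Qed.

Lemma lshiftD J p q : lshift_by J (p + q) = lshift_by J p + lshift_by J q.
Proof. by rewrite -{1}[p]scale1r lshift_lin scale1r. Qed.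

Lemma lshiftZ J b p : lshift_by J (b *: p) = b *: lshift_by J p.
Proof. by rewrite -[b *: p]addr0 lshift_lin lshift_by0 addr0. Qed.

Lemma lshift_sum J I r (Q : pred I) (F : I -> A) :
  lshift_by J (\sum_(i <- r | Q i) F i) = \sum_(i <- r | Q i) lshift_by J (F i).
Proof. exact: (big_morph (lshift_by J) (lshiftD J) (lshift_by0 J)). Qed.

(** The candidate for f_{n+1}(X_j h). The sum is (1 (x) f_n)(P e), where e is [h] with the leading
    letter X_{j'} removed. *)
Definition wenzl_rhs (x : cplx R) n j h : A :=
  - (x * (a j)^*) *:
    (\sum_i a i *: lmul [:: i] (pj P n (lmul [:: rev_ord i] (lshift_by [:: rev_ord j] h))))
  + lmul [:: j] h.

Lemma lshift_wenzl_rhs x n i j h :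
  lshift_by [:: i] (wenzl_rhs x n j h) =
  - (x * (a j)^*) * a i *: pj P n (lmul [:: rev_ord i] (lshift_by [:: rev_ord j] h))
  + (i == j)%:R *: h.
Proof.
rewrite /wenzl_rhs lshift_lin lshift1_lmul lshift_sum.
rewrite (bigD1 i isT) big1 => [|k ki].
  by rewrite /= addr0 lshiftZ lshift1_lmul eqxx scale1r scalerA.
by rewrite lshiftZ lshift1_lmul eq_sym (negbTE ki) scale0r scaler0.
Qed.

Context (a_unit : forall i, `|a i| ^+ 2 * `|a (rev_ord i)| ^+ 2 = 1).
Context (c : nat -> cplx R).
Context (c0 : c 0%N = 0)
  (cS : forall n, c n.+1 * (\sum_i `|a i| ^+ 2 - c n) = 1).

(** In positive degree the sum is the expansion of [e] along first letters. In degree 0 the sum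
    vanishes, and the identity survives because c_0 = 0. *)
Lemma scale_pj_expand n e : e \in in_Hn P n ->
  c n *: pj P n (\sum_i lmul [:: i] (lshift_by [:: i] e)) = c n *: e.
Proof.
case: n => [|n] eH; first by rewrite c0 !scale0r.
by rewrite -(lshift_expand (in_Hn_tpow eH)) pj_id.
Qed.

(** By uniqueness of the projection it suffices that the candidate lies in H_{n+1} and has the same
    inner products as X_j h with H_{n+1}. Membership is checked with [in_HnS], and its last equation
    is exactly the recursion for c. *)
Lemma wenzl n j h : h \in in_Hn P n ->
  pj P n.+1 (lmul [:: j] h) = wenzl_rhs (c n) n j h.
Proof.
elim: n j h => [|n IH] j h hH.
  rewrite /wenzl_rhs c0 mul0r oppr0 scale0r add0r pj_id//.
  by apply/in_H1/tpow_lmul/in_Hn_tpow/hH.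
pose e := lshift_by [:: rev_ord j] h.
have eH : e \in in_Hn P n by exact: in_Hn_lshift.
apply: pj_uniq; last first.
  move=> g gH; rewrite /wenzl_rhs dotPl -/e.
  set S := \sum_i _; have -> : dot S g = 0; last by rewrite mulr0 add0r.
  rewrite /S dot_suml -[RHS](dot0r e) -(lshift_quadratic gH) dot_sumr.
  apply: eq_bigr => i _.
  rewrite [LHS]dotZl dot_lmul (dot_pjl _ (in_Hn_lshift i gH)) dot_lmul.
  by rewrite -lshift_cat [RHS]dotZr conjCK.
apply: in_HnS => [|i|].
- apply: tpow_lin; last exact/tpow_lmul/in_Hn_tpow/hH.
  apply: tpow_sum => i; apply: tpowZ; apply: tpow_lmul.
  exact: (in_Hn_tpow (pj_in _ _ _)).
- by rewrite lshift_wenzl_rhs; apply: in_Hn_lin; [exact: pj_in|exact: in_HnZ].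
(* It remains to contract the first two letters with P. The induction hypothesis turns each term
   into multiples of [e], of [f i] and, for i = j only, of [h] without X_{j'}, which is [e]
   again. *)
pose b := - (c n.+1 * (a j)^*).
pose f i := pj P n (lmul [:: i] (lshift_by [:: i] e)).
have term i : (a i)^* *: lshift_by [:: i; rev_ord i] (wenzl_rhs (c n.+1) n.+1 j h) =
    (b * `|a i| ^+ 2) *: e + (- (b * c n)) *: f i
    + ((i == j)%:R * (a i)^*) *: lshift_by [:: rev_ord i] h.
  rewrite (lshift_cat [:: i]) lshift_wenzl_rhs -/e -/b lshift_lin IH//.
  rewrite lshift_wenzl_rhs eqxx scale1r rev_ordK lshiftZ scaler_nested.
  have -> : (a i)^* * (b * a i) = b * `|a i| ^+ 2 by rewrite normCK; ring.
  (* Applying the recursion twice produces |a_i|^2 |a_{i'}|^2 = 1, so this coefficient does not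
     depend on i and the [f i] can be summed. *)
  have -> : b * `|a i| ^+ 2 * (- (c n * (a (rev_ord i))^*) * a (rev_ord i)) = - (b * c n).
    by rewrite -[RHS]mulr1 -(a_unit i) !normCK; ring.
  by [].
rewrite (eq_bigr _ (fun i _ => term i)) sum_scaler_delta.
have -> : - (b * c n) *: (\sum_i f i) = - (b * c n) *: e.
  by apply: scaler_eqNM; rewrite -pj_sum; exact: scale_pj_expand.
apply: scaler_eq0_sum; rewrite -mulr_sumr.
transitivity ((a j)^* * (1 - c n.+1 * (\sum_i `|a i| ^+ 2 - c n))).
  by rewrite /b; ring.
by rewrite cS subrr mulr0.
Qed.

Lemma lshift_pj_lmul n i j h : h \in in_Hn P n ->
  lshift_by [:: i] (pj P n.+1 (lmul [:: j] h)) =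
  - (c n * (a j)^*) * a i *: pj P n (lmul [:: rev_ord i] (lshift_by [:: rev_ord j] h))
  + (i == j)%:R *: h.
Proof. by move=> hH; rewrite wenzl// lshift_wenzl_rhs. Qed.

End Wenzl.

(** * The Fock space *)

Lemma cvgn_eq (T : topologicalType) (u v : nat -> T) (l : T) :
  u @ \oo --> l -> u =1 v -> v @ \oo --> l.
Proof. by move=> ul /funext <-. Qed.

Section ComplexLimits.
Context {R : realType}.
Local Notation C := (cplx R).
Implicit Types (u v : nat -> C) (l : C).

Lemma cvg_cplxP u l : u @ \oo --> l <->
  forall e : R, 0 < e -> \forall n \near \oo, `|l - u n| <= e%:C%C.
Proof.
split=> [/cvgrPdist_le ul e e0|ul]; first by apply: ul; rewrite ltcR.
apply/cvgrPdist_le => e e0.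
have eE : e = (complex.Re e)%:C%C by rewrite RRe_real// gtr0_real.
by rewrite eE; apply: ul; rewrite -ltcR -eE.
Qed.

Lemma cvg_cplx u (x y : R) :
  (fun n => complex.Re (u n)) @ \oo --> x -> (fun n => complex.Im (u n)) @ \oo --> y ->
  u @ \oo --> (Complex x y : C).
Proof.
move=> /cvgrPdist_le ux /cvgrPdist_le uy; apply/cvg_cplxP => e e0.
have e20 : 0 < e / 2 by rewrite divr_gt0.
near=> n.
have hx : `|x - complex.Re (u n)| <= e / 2 by near: n; exact: ux.
have hy : `|y - complex.Im (u n)| <= e / 2 by near: n; exact: uy.
rewrite normc_def lecR -[leRHS](ger0_norm (ltW e0)) -sqrtr_sqr; apply: ler_wsqrtr.
move: hx hy; rewrite !ler_norml; case: (u n) => p q /= /andP[? ?] /andP[? ?].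
have : (x - p) ^+ 2 <= (e / 2) ^+ 2 by nra.
have : (y - q) ^+ 2 <= (e / 2) ^+ 2 by nra.
nra.
Unshelve. all: by end_near. Qed.

Lemma cvg_cplx_conj u l : u @ \oo --> l -> (fun n => (u n)^*) @ \oo --> l^*.
Proof.
move=> /cvg_cplxP ul; apply/cvg_cplxP => e /ul; apply: filterS => n.
by rewrite -rmorphB norm_conjC.
Qed.

Lemma conjC_real (r : R) : (r%:C%C : C)^* = r%:C%C.
Proof. by apply/conj_Creal/complex_realP; exists r. Qed.

Lemma cvg_cplx_real (v : nat -> R) (x : R) : v @ \oo --> x ->
  (fun n => (v n)%:C%C : C) @ \oo --> (x%:C%C : C).
Proof. by move=> vx; apply: cvg_cplx => //=; exact: cvg_cst. Qed.

End ComplexLimits.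

Section FockNorm.
Context {R : realType} {m : nat} {P : ncpoly (cplx R) m}.
Local Notation C := (cplx R).
Local Notation A := (ncpoly C m).
Local Notation fock := (fock P).
Implicit Types (x y z : fock) (p q : A).

Lemma nsqDE p q : nsq (p + q) = nsq p + nsq q + 2 * complex.Re (dot p q).
Proof.
rewrite /nsq dotDl !dotDr !raddfD /= (dotC p q); case: (dot p q) => b c /=.
ring.
Qed.

Lemma nsqi p : nsq ('i%C *: p) = nsq p.
Proof.
rewrite /nsq dotZl dotZr; case: (dot p p) => b c /=; ring.
Qed.

Lemma nsqN p : nsq (- p) = nsq p.
Proof. by rewrite /nsq -scaleN1r dotZl dotZr rmorphN1 mulrA mulrNN mulr1 mul1r. Qed.

(** A weak form of Cauchy-Schwarz, from positivity of the squared norms of p + q and p - q; it is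
    enough for absolute convergence of inner products. *)
Lemma normRe_dot p q : `|complex.Re (dot p q)| <= nsq p + nsq q.
Proof.
have h1 := nsq_ge0 (p + q); have h2 := nsq_ge0 (p + - q).
rewrite !nsqDE nsqN -scaleN1r dotZr rmorphN1 mulN1r in h1 h2.
have := nsq_ge0 p; have := nsq_ge0 q; rewrite ler_norml.
by move: h1 h2; case: (dot p q) => b c /= h1 h2 hq hp; apply/andP; split; lra.
Qed.

Lemma normIm_dot p q : `|complex.Im (dot p q)| <= nsq p + nsq q.
Proof.
have := normRe_dot p ('i%C *: q); rewrite nsqi dotZr.
by case: (dot p q) => b c /=; rewrite mul0r sub0r mulN1r opprK.
Qed.

(** The squared norm. Estimates are made on it rather than on [fnorm], to avoid square roots. *)
Definition fsq x : R := limn (series (fun n => nsq (x n))).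

Lemma fsq_cvg x : cvgn (series (fun n => nsq (x n))).
Proof. by have /in_fockP[] := fock_valP x. Qed.

Lemma partial_le_fsq x n : \sum_(i < n) nsq (x i) <= fsq x.
Proof.
have := nondecreasing_cvgn_le _ (@fsq_cvg x) n; rewrite /series/= big_mkord; apply.
by apply/nondecreasing_seqP => k; rewrite /series/= big_nat_recr//= lerDl nsq_ge0.
Qed.

Lemma fsq_ge0 x : 0 <= fsq x.
Proof. by apply: le_trans (partial_le_fsq x 0); rewrite big_ord0. Qed.

Lemma nsq_le_fsq x n : nsq (x n) <= fsq x.
Proof.
apply: le_trans (partial_le_fsq x n.+1); rewrite big_ord_recr/= lerDr.
by apply: sumr_ge0 => i _; exact: nsq_ge0.
Qed.

Lemma fsq_le x (b : R) : (forall n, \sum_(i < n) nsq (x i) <= b) -> fsq x <= b.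
Proof.
move=> xb; apply: limr_le; first exact: fsq_cvg.
by apply: nearW => n; rewrite /series/= big_mkord.
Qed.

Lemma fsq_leM x y (b : R) : 0 <= b -> (forall n, nsq (x n) <= b * nsq (y n)) ->
  fsq x <= b * fsq y.
Proof.
move=> b0 xy; apply: fsq_le => n.
apply: (@le_trans _ _ (\sum_(i < n) b * nsq (y i))); first by apply: ler_sum => i _.
by rewrite -mulr_sumr ler_wpM2l// partial_le_fsq.
Qed.

Lemma fnormE x : fnorm x ^+ 2 = fsq x.
Proof. by rewrite sqr_sqrtr// fsq_ge0. Qed.

Lemma fnorm_ge0 x : 0 <= fnorm x. Proof. exact: sqrtr_ge0. Qed.

Lemma fock_ext x y : (forall n, x n = y n) -> x = y.
Proof. by move=> xy; apply/val_inj/funext. Qed.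

Lemma fock_linE c x y n : (c *: x + y) n = c *: x n + y n.
Proof. by []. Qed.

Lemma fock0E n : (0 : fock) n = 0. Proof. by []. Qed.

Lemma fockBE x y n : (x - y) n = x n - y n. Proof. by []. Qed.

Lemma fockDE x y n : (x + y) n = x n + y n. Proof. by []. Qed.

Lemma fockZE c x n : (c *: x) n = c *: x n. Proof. by []. Qed.

Lemma fsq_single x n : (forall k, k != n -> x k = 0) -> fsq x = nsq (x n).
Proof.
move=> x0; apply/eqP; rewrite eq_le nsq_le_fsq andbT; apply: fsq_le => N.
have [nN|Nn] := ltnP n N.
  rewrite (bigD1 (Ordinal nN))//= big1 ?addr0// => i ne.
  by rewrite x0 ?nsq0//; apply: contra ne => /eqP e; apply/eqP/val_inj.
rewrite big1 ?nsq_ge0// => i _; rewrite x0 ?nsq0//.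
by rewrite neq_ltn (leq_trans (ltn_ord i)).
Qed.

Lemma fsqD_le x y : fsq (x + y) <= 2 * (fsq x + fsq y).
Proof.
apply: fsq_le => n.
apply: (@le_trans _ _ (\sum_(i < n) 2 * (nsq (x i) + nsq (y i)))).
  by apply: ler_sum => i _; exact: nsqD_le.
by rewrite -mulr_sumr ler_wpM2l// big_split lerD//= partial_le_fsq.
Qed.

Lemma bounded_byP (T : fock -> fock) (b : R) : 0 <= b ->
  bounded_by T b <-> forall x, fsq (T x) <= b ^+ 2 * fsq x.
Proof.
move=> b0; split=> [[_ Tb] x|Tb].
  rewrite -!fnormE -exprMn; apply: lerXn2r; rewrite ?nnegrE ?fnorm_ge0//.
  by rewrite mulr_ge0 ?fnorm_ge0.
split=> // x; move: (Tb x); rewrite -!fnormE -exprMn ler_sqr// nnegrE.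
  exact: fnorm_ge0.
by rewrite mulr_ge0// fnorm_ge0.
Qed.

Lemma bounded_by_le (T : fock -> fock) (b c : R) :
  bounded_by T b -> b <= c -> bounded_by T c.
Proof.
move=> [b0 Tb] bc; split; first exact: le_trans bc.
by move=> x; apply: (le_trans (Tb x)); rewrite ler_wpM2r// fnorm_ge0.
Qed.

(** Real and imaginary parts are dominated by the summable sequence |x_n|^2 + |y_n|^2, hence
    converge absolutely. *)
Lemma fdot_cvg x y : series (fun n => dot (x n) (y n)) @ \oo --> fdot x y.
Proof.
have cvgS (f : A -> A -> R) : (forall p q, `|f p q| <= nsq p + nsq q) ->
    cvgn (series (fun n => f (x n) (y n))).
  move=> fle; apply: normed_cvg; apply: (@series_le_cvg _ _
    ((fun n => nsq (x n)) + (fun n => nsq (y n)))) => [n|n|n|].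
  - exact: normr_ge0.
  - by rewrite addr_ge0 ?nsq_ge0.
  - exact: fle.
  - by apply: is_cvg_seriesD; exact: fsq_cvg.
have /cvg_ex[r hr] := cvgS _ normRe_dot; have /cvg_ex[s hs] := cvgS _ normIm_dot.
have cv : series (fun n => dot (x n) (y n)) @ \oo --> (Complex r s : C).
  apply: cvg_cplx.
    by apply: cvgn_eq hr _ => n; rewrite /series/= raddf_sum.
  by apply: cvgn_eq hs _ => n; rewrite /series/= raddf_sum.
by apply: cvgP cv.
Qed.

Lemma fdotP x y (l : C) : series (fun n => dot (x n) (y n)) @ \oo --> l -> fdot x y = l.
Proof. by move=> xl; apply: cvg_lim xl; exact: norm_hausdorff. Qed.

Lemma fdotPl c x y z : fdot (c *: x + y) z = c * fdot x z + fdot y z.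
Proof.
apply: fdotP; apply: cvgn_eq (cvgD (cvgM (cvg_cst c) (@fdot_cvg x z)) (@fdot_cvg y z)) _ => n.
transitivity (c * (\sum_(0 <= i < n) dot (x i) (z i)) + \sum_(0 <= i < n) dot (y i) (z i)).
  by [].
by rewrite mulr_sumr -big_split; apply: eq_bigr => i _; rewrite dotPl.
Qed.

Lemma fdotC x y : fdot y x = (fdot x y)^*.
Proof.
apply: fdotP; apply: cvgn_eq (cvg_cplx_conj (@fdot_cvg x y)) _ => n.
by rewrite /series /= rmorph_sum; apply: eq_bigr => i _; rewrite [RHS]dotC.
Qed.

Lemma fdotPr c x y z : fdot z (c *: x + y) = c^* * fdot z x + fdot z y.
Proof.
by rewrite fdotC fdotPl (fdotC z x) (fdotC z y) rmorphD rmorphM /= !conjCK.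
Qed.

Lemma fdotxx x : fdot x x = (fsq x)%:C%C.
Proof.
apply: fdotP; apply: cvgn_eq (cvg_cplx_real (@fsq_cvg x)) _ => n.
by rewrite /series /= rmorph_sum; apply: eq_bigr => i _; rewrite /= nsqE.
Qed.

(* The bound comes from [0 <= |x - t y|^2]. *)
Lemma fdot_young x y (r t : R) : 0 < t -> fdot x y = r%:C%C -> 2 * r <= fsq x / t + t * fsq y.
Proof.
move=> t0 xy; have := fsq_ge0 ((- t%:C%C : C) *: y + x).
rewrite -lecR -fdotxx fdotPl !fdotPr (fdotC x y) xy !fdotxx.
have -> : (- t%:C%C : C) ^* = - t%:C%C by rewrite rmorphN /= conjC_real.
rewrite conjC_real.
rewrite -!(rmorphN, rmorphM, rmorphD) /= lecR => h.
rewrite -subr_ge0 -(pmulr_rge0 _ t0).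
have -> : t * (fsq x / t + t * fsq y - 2 * r) =
    t * (t * fsq y) + fsq x * (t / t) - 2 * t * r by ring.
rewrite divff ?gt_eqF//; lra.
Qed.

End FockNorm.

(** * Norm closures of algebras of operators *)

Section Operators.
Context {R : realType} {m : nat} {P : ncpoly (cplx R) m}.
Local Notation C := (cplx R).
Local Notation fock := (fock P).
Implicit Types (T U V : fock -> fock) (x y z : fock) (B : set (fock -> fock)).

Section Linear.
Context {T : fock -> fock} (Tlin : linear T).

Lemma op0 : T 0 = 0.
Proof. by have := Tlin (-1) 0 0; rewrite scaler0 addr0 scaleN1r addNr. Qed.

Lemma opD x y : T (x + y) = T x + T y.
Proof. by have := Tlin 1 x y; rewrite !scale1r. Qed.

Lemma opZ c x : T (c *: x) = c *: T x.
Proof. by have := Tlin c x 0; rewrite op0 !addr0. Qed.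

Lemma opB x y : T (x - y) = T x - T y.
Proof. by rewrite opD -scaleN1r opZ scaleN1r. Qed.

Lemma op_sum I r (Q : pred I) (F : I -> fock) :
  T (\sum_(i <- r | Q i) F i) = \sum_(i <- r | Q i) T (F i).
Proof. exact: (big_morph T opD op0). Qed.

End Linear.

Lemma fock_sumE I r (Q : pred I) (F : I -> fock) n :
  (\sum_(i <- r | Q i) F i : fock) n = \sum_(i <- r | Q i) F i n.
Proof. exact: (big_morph (fun x : fock => x n) (fun x y => fockDE x y n) (fock0E n)). Qed.

Definition absR (c : C) : R := complex.Re `|c|.

Lemma absRE c : (absR c)%:C%C = `|c|.
Proof. by rewrite RRe_real// normr_real. Qed.

Lemma absR_ge0 c : 0 <= absR c.
Proof. by rewrite -ler0c absRE. Qed.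

Lemma nsqZE c p : nsq (c *: p : ncpoly C m) = absR c ^+ 2 * nsq p.
Proof.
rewrite nsqZ; congr (_ * _); apply: complexI.
have -> : (complex.Re (`|c| ^+ 2))%:C%C = `|c| ^+ 2 :> C.
  by apply: RRe_real; rewrite realX// normr_real.
by rewrite -absRE rmorphXn.
Qed.

(** The constant is twice the sharp one because [fsqD_le] takes the place of the triangle
    inequality: with s = |c| b, the squared norm is at most 2 (s^2 + d^2) |x|^2, and this is below
    (2 (s + d))^2 |x|^2. *)
Lemma bounded_by_lin c T U b d : bounded_by T b -> bounded_by U d ->
  bounded_by (fun x => c *: T x + U x) (2 * (absR c * b + d)).
Proof.
move=> Tb Ud; have b0 := Tb.1; have d0 := Ud.1; have c0 := absR_ge0 c.
apply/bounded_byP => [|x]; first by rewrite mulr_ge0// addr_ge0// mulr_ge0.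
move/(bounded_byP _ b0)/(_ x): Tb => Tb; move/(bounded_byP _ d0)/(_ x): Ud => Ud.
have cT : fsq (c *: T x) <= absR c ^+ 2 * fsq (T x).
  by apply: fsq_leM => [|n]; rewrite ?sqr_ge0// fockZE nsqZE.
apply: (le_trans (fsqD_le _ _)).
have : fsq (c *: T x) <= (absR c * b) ^+ 2 * fsq x.
  apply: (le_trans cT); rewrite exprMn -[leRHS]mulrA.
  by apply: ler_wpM2l Tb; exact: sqr_ge0.
have := mulr_ge0 c0 b0; move: (absR c * b) Ud (fsq_ge0 x) => e.
move: (fsq x) (fsq (U x)) (fsq _) => f g h gd f0 e0 he.
have -> : (2 * (e + d)) ^+ 2 * f = 4 * (e ^+ 2 * f) + 8 * (e * d * f) + 4 * (d ^+ 2 * f).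
  by ring.
have := mulr_ge0 (mulr_ge0 e0 d0) f0; have := mulr_ge0 (sqr_ge0 e) f0.
have := mulr_ge0 (sqr_ge0 d) f0.
move: (e ^+ 2 * f) (d ^+ 2 * f) (e * d * f) gd he => p q r gd he p0 q0 r0.
by rewrite {e0 d0 c0 b0 cT Tb}; lra.
Qed.

Lemma bounded_by_comp T U b d : bounded_by T b -> bounded_by U d ->
  bounded_by (T \o U) (b * d).
Proof.
move=> [b0 Tb] [d0 Ud]; split; first exact: mulr_ge0.
by move=> x; apply: (le_trans (Tb _)); rewrite -mulrA ler_wpM2l.
Qed.

Lemma bounded_by_id : bounded_by (idfun : fock -> fock) 1.
Proof. by split=> // x; rewrite mul1r. Qed.

Lemma bop_lin c T U : bop T -> bop U -> bop (fun x => c *: T x + U x).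
Proof.
move=> [Tl [b Tb]] [Ul [d Ud]]; split; last first.
  by exists (2 * (absR c * b + d)); exact: bounded_by_lin.
by move=> e x y; rewrite Tl Ul !scalerDr !scalerA addrACA (mulrC c).
Qed.

Lemma bop_comp T U : bop T -> bop U -> bop (T \o U).
Proof.
move=> [Tl [b Tb]] [Ul [d Ud]]; split; last first.
  by exists (b * d); exact: bounded_by_comp.
by move=> e x y; rewrite /= Ul Tl.
Qed.

Lemma bop_id : bop (idfun : fock -> fock).
Proof. by split=> //; exists 1; exact: bounded_by_id. Qed.

Lemma bop_sub T U : bop T -> bop U -> bop (T \- U).
Proof.
move=> Tb Ub; rewrite (_ : T \- U = fun x => -1 *: U x + T x); first exact: bop_lin.
by apply/funext => x; rewrite scaleN1r addrC.
Qed.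

Lemma fsq0 : fsq (0 : fock) = 0.
Proof. by rewrite (@fsq_single _ _ _ _ 0%N) => [|k _]; rewrite fock0E ?nsq0. Qed.

(** Approximation stated with explicit bounds, so that the infimum in [opnorm] has to be handled
    only once, in [norm_closureP]. *)
Definition op_approx B T := forall e : R, 0 < e -> exists2 U, B U & bounded_by (T \- U) e.

Lemma opnorm_lt T e : bop T -> opnorm T < e -> bounded_by T e.
Proof.
move=> [_ [b Tb]]; have hi : has_inf [set M | bounded_by T M].
  by split; [exists b|exists 0 => M []].
rewrite -subr_gt0 => /inf_adherent/(_ hi)[M TM]; rewrite /opnorm addrC subrK => Me.
exact: bounded_by_le (ltW Me).
Qed.

Lemma opnorm_le T e : bounded_by T e -> opnorm T <= e.
Proof. by move=> Te; apply: ge_inf => //; exists 0 => M []. Qed.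

Lemma norm_closureP B T : B `<=` bop (P := P) ->
  norm_closure B T <-> bop T /\ op_approx B T.
Proof.
move=> Bb; split=> -[Tb TB]; split=> // e e0.
  have [U BU TU] := TB _ e0; exists U; first exact: BU.
  exact: (opnorm_lt (bop_sub Tb (Bb _ BU)) TU).
(* Halving turns the large inequality given by a bound into the strict one of the closure. *)
have [|U BU TU] := TB (e / 2); first by rewrite divr_gt0.
exists U; first exact: BU.
by rewrite (le_lt_trans (opnorm_le TU))// gtr_pMr// invf_lt1// ltr1n.
Qed.

Lemma approx_self B T : B T -> op_approx B T.
Proof.
move=> BT e e0; exists T => //; apply/bounded_byP; first exact: ltW.
by move=> x; rewrite /= subrr fsq0 mulr_ge0 ?sqr_ge0 ?fsq_ge0.
Qed.

Lemma approx_trans B B' T : (forall U, B' U -> op_approx B U) -> op_approx B' T -> op_approx B T.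
Proof.
(* Quarters, because [bounded_by_lin] doubles the sum of the two errors. *)
move=> BB' TB' e e0; have e4 : 0 < e / 4 by rewrite divr_gt0.
have [U /BB' UB TU] := TB' _ e4; have [V BV UV] := UB _ e4.
exists V => //; apply: (@bounded_by_le _ _ _ _ (2 * (absR 1 * (e / 4) + e / 4))).
  rewrite (_ : T \- V = fun x => 1 *: (T \- U) x + (U \- V) x); first exact: bounded_by_lin.
  by apply/funext => x; rewrite scale1r /= addrA subrK.
by rewrite /absR normr1 /= mul1r; lra.
Qed.

(** The choice of error for a factor of norm at most f; the summand 1 keeps the denominator positive
    when f = 0. *)
Lemma mul_div_shrink (f e : R) : 0 <= f -> 0 < e -> f * (e / (4 * (f + 1))) <= e / 4.
Proof.
move=> f0 e0; rewrite invfM [e * _]mulrA mulrCA ler_piMr//; first by rewrite divr_ge0// ltW.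
by rewrite ler_pdivrMr ?ltr_wpDl// mul1r lerDl.
Qed.

Lemma approx_lin B c T U :
  (forall T' U', B T' -> B U' -> B (fun x => c *: T' x + U' x)) ->
  op_approx B T -> op_approx B U -> op_approx B (fun x => c *: T x + U x).
Proof.
move=> Blin TB UB e e0; have k0 := absR_ge0 c.
have h0 : 0 < e / (4 * (absR c + 1)) by rewrite divr_gt0// mulr_gt0// ltr_wpDl.
have [T' BT' TT'] := TB _ h0; have [|U' BU' UU'] := UB (e / 4); first by rewrite divr_gt0.
exists (fun x => c *: T' x + U' x); first exact: Blin.
apply: (@bounded_by_le _ _ _ _ (2 * (absR c * (e / (4 * (absR c + 1))) + e / 4))).
  rewrite (_ : _ \- _ = fun x => c *: (T \- T') x + (U \- U') x).
    exact: bounded_by_lin.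
  by apply/funext => x; rewrite /= scalerBr opprD addrACA.
suff : absR c * (e / (4 * (absR c + 1))) <= e / 4 by lra.
exact: mul_div_shrink.
Qed.

Lemma approx_comp B T U : (forall T' U', B T' -> B U' -> B (T' \o U')) ->
  B `<=` bop (P := P) -> bop T -> op_approx B T -> op_approx B U -> op_approx B (T \o U).
Proof.
move=> Bcomp Bb [Tl [b Tb]] TB UB e e0; have b0 := Tb.1.
have h0 : 0 < e / (4 * (b + 1)) by rewrite divr_gt0// mulr_gt0// ltr_wpDl.
(* From TU - T'U' = T(U - U') + (T - T')U': U' is chosen first, since the accuracy required of T'
   depends on the bound d of U'. *)
have [U' BU' UU'] := UB _ h0; have [_ [d U'd]] := Bb _ BU'; have d0 := U'd.1.
have k0 : 0 < e / (4 * (d + 1)) by rewrite divr_gt0// mulr_gt0// ltr_wpDl.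
have [T' BT' TT'] := TB _ k0; exists (T' \o U'); first exact: Bcomp.
apply: (@bounded_by_le _ _ _ _
  (2 * (absR 1 * (b * (e / (4 * (b + 1)))) + (e / (4 * (d + 1))) * d))).
  rewrite (_ : _ \- _ = fun x => 1 *: (T \o (U \- U')) x + ((T \- T') \o U') x).
    by apply: bounded_by_lin; exact: bounded_by_comp.
  by apply/funext => x; rewrite /= scale1r (opB Tl) addrA subrK.
rewrite /absR normr1 /= mul1r; have := mul_div_shrink b0 e0; have := mul_div_shrink d0 e0.
by rewrite (mulrC d); lra.
Qed.

(** Since |V'y|^2 = (V V'y, y), [fdot_young] with t = b^2 gives 2 |V'y|^2 <= |V V'y|^2 / b^2 + b^2
    |y|^2, and the first term is at most |V'y|^2. *)
Lemma adjoint_bounded_by V V' b : 0 < b -> adjoint V V' -> bounded_by V b -> bounded_by V' b.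
Proof.
move=> b0 VV' Vb; apply/bounded_byP => [|y]; first exact: ltW.
have b20 : 0 < b ^+ 2 by rewrite exprn_gt0.
have /(fdot_young b20) : fdot (V (V' y)) y = (fsq (V' y))%:C%C by rewrite VV' fdotxx.
have : fsq (V (V' y)) / b ^+ 2 <= fsq (V' y).
  by rewrite ler_pdivrMr// mulrC; exact: (bounded_byP _ (ltW b0)).1 Vb _.
by move: (_ / b ^+ 2) (fsq (V' y)) (b ^+ 2 * _) => p q r; lra.
Qed.

Lemma adjoint_lin c T U T' U' : adjoint T T' -> adjoint U U' ->
  adjoint (fun x => c *: T x + U x) (fun x => c^* *: T' x + U' x).
Proof. by move=> TT' UU' x y; rewrite fdotPl fdotPr conjCK TT' UU'. Qed.

Lemma adjoint_comp T U T' U' : adjoint T T' -> adjoint U U' ->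
  adjoint (T \o U) (U' \o T').
Proof. by move=> TT' UU' x y; rewrite /= TT' UU'. Qed.

Lemma adjoint_sub T U T' U' : adjoint T T' -> adjoint U U' ->
  adjoint (T \- U) (T' \- U').
Proof.
move=> TT' UU' x y; have subE (u v : fock) : u - v = -1 *: v + u.
  by rewrite scaleN1r addrC.
by rewrite /= !subE fdotPl fdotPr rmorphN1 TT' UU'.
Qed.

Lemma norm_closure_cstar B : B `<=` bop (P := P) -> B idfun ->
  (forall (c : C) T U, B T -> B U -> B (fun x => c *: T x + U x)) ->
  (forall T U, B T -> B U -> B (T \o U)) ->
  (forall T, B T -> exists2 T', B T' & adjoint T T') ->
  unital_cstar_subalgebra (norm_closure B).
Proof.
move=> Bb B1 Blin Bcomp Badj; have E T := norm_closureP T Bb.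
have clb : norm_closure B `<=` bop (P := P) by move=> T [].
split; first exact: clb.
- by apply/E; split; [exact: bop_id|exact: approx_self].
- move=> c T U /E[Tb TB] /E[Ub UB]; apply/E; split; first exact: bop_lin.
  by apply: approx_lin TB UB => T' U'; exact: Blin.
- move=> T U /E[Tb TB] /E[Ub UB]; apply/E; split; first exact: bop_comp.
  exact: (approx_comp Bcomp Bb Tb TB UB).
split=> [T T' /E[Tb TB] T'b TT'|T /(norm_closureP _ clb)[Tb TB]].
  apply/E; split; first exact: T'b.
  (* An adjoint U' of U in B approximates T' equally well, as T' - U' is the adjoint of T - U. *)
  move=> e e0; have [U BU TU] := TB _ e0; have [U' BU' UU'] := Badj _ BU.
  exists U'; first exact: BU'.
  exact: (adjoint_bounded_by e0 (adjoint_sub TT' UU') TU).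
apply/E; split; first exact: Tb.
by apply: approx_trans TB => U /E[].
Qed.

Lemma fock_embE n (h : Hn P n) k : fock_emb h k = if k == n then Hn_val h else 0.
Proof. by []. Qed.

Definition emb n x : fock := fock_emb (fock_comp n x).

Lemma embE n x k : emb n x k = if k == n then x n else 0.
Proof. by []. Qed.

Definition trunc x N : fock := \sum_(k < N) emb k x.

Lemma truncE x N n : trunc x N n = if (n < N)%N then x n else 0.
Proof.
rewrite /trunc fock_sumE; under eq_bigr do rewrite embE.
case: ifPn => nN; last first.
  by rewrite big1// => i _; rewrite ifF//; apply/negbTE/eqP => e; rewrite e ltn_ord in nN.
rewrite (bigD1 (Ordinal nN))//= eqxx big1 ?addr0// => i ne; rewrite ifF//.
by apply/negbTE; apply: contra ne => /eqP e; apply/eqP/val_inj.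
Qed.

Lemma fsq_trunc x N : fsq (x - trunc x N) <= fsq x - \sum_(i < N) nsq (x i).
Proof.
set y := x - trunc x N.
have yE i : y i = if (i < N)%N then 0 else x i.
  by rewrite fockBE truncE; case: ifP; rewrite ?subrr ?subr0.
clearbody y; apply: fsq_le => n; rewrite lerBrDr; apply: le_trans (partial_le_fsq x (N + n)).
rewrite big_split_ord /= [leLHS]addrC lerD2l.
apply: (@le_trans _ _ (\sum_(i < N + n) nsq (y i))).
  by rewrite [in leRHS]addnC big_split_ord/= lerDl; apply: sumr_ge0 => i _; exact: nsq_ge0.
rewrite big_split_ord /= big1 ?add0r => [|i _]; last by rewrite yE ltn_ord nsq0.
by apply: ler_sum => i _; rewrite yE ltnNge leq_addr.
Qed.

Lemma trunc_approx x (e : R) : 0 < e -> exists N, fsq (x - trunc x N) <= e.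
Proof.
move=> e0; have /cvgrPdist_le/(_ _ e0)[N _ /(_ N (leqnn _))] := @fsq_cvg _ _ _ x.
rewrite /= /series/= big_mkord => h; exists N; apply: le_trans (fsq_trunc _ _) _.
exact: le_trans (ler_norm _) h.
Qed.

(** Linearity gives this on finitely supported vectors; boundedness extends it to all of the Fock
    space through truncations. *)
Lemma diag_apply T n : bop T ->
  (forall k (h : Hn P k), k != n -> T (fock_emb h) n = 0) ->
  forall x, T x n = T (emb n x) n.
Proof.
move=> [Tl [b Tb]] Tn x; have b0 := Tb.1; move/(bounded_byP _ b0): Tb => Tb.
suff : T (x - emb n x) n = 0.
  by rewrite (opB Tl) fockBE => /eqP; rewrite subr_eq0 => /eqP.
set y := x - _; have yn : y n = 0 by rewrite fockBE embE eqxx subrr.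
have emb0 : emb n y = 0.
  by apply: fock_ext => k; rewrite embE yn if_same.
have bs : 0 <= b ^+ 2 by exact: sqr_ge0.
suff : nsq (T y n) <= 0.
  move=> h; have /eqP h0 : nsq (T y n) == 0 by rewrite eq_le h nsq_ge0.
  by apply: dot_eq0; rewrite -nsqE h0.
apply/ler_addgt0Pr => e e0; rewrite add0r.
have [|N hN] := @trunc_approx y (e / (b ^+ 2 + 1)); first by rewrite divr_gt0// ltr_wpDl.
(* The truncation of [y] contributes nothing in degree n: its block n is zero, and [Tn] excludes the
   other blocks. Only the small remainder is left. *)
have -> : T y n = T (y - trunc y N) n.
  rewrite (opB Tl) fockBE /trunc (op_sum Tl) fock_sumE big1 ?subr0// => k _.
  by have [->|kn] := eqVneq (k : nat) n; [rewrite emb0 (op0 Tl)|rewrite Tn].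
apply: (le_trans (nsq_le_fsq _ _)); apply: (le_trans (Tb _)).
apply: (@le_trans _ _ (b ^+ 2 * (e / (b ^+ 2 + 1)))); first exact: ler_wpM2l.
rewrite mulrCA ler_piMr ?(ltW e0)// ler_pdivrMr ?ltr_wpDl// mul1r lerDl//.
Qed.

End Operators.

(** * Creation, annihilation and diagonal operators *)

Record cvgseq (R : realType) := CvgSeq { cseq :> nat -> cplx R ; cseqP : cvgn cseq }.

Section ConvergentSequences.
Context {R : realType}.
Local Notation C := (cplx R).
Implicit Types d : cvgseq R.

Lemma cvgseq_bounded d : exists2 b : R, 0 <= b & forall n, absR (d n) <= b.
Proof.
have /= [M [Mr Mb]] := cvg_seq_bounded (@cseqP _ d).
have db n : `|d n| <= `|M| + 1.
  by apply: (Mb (`|M| + 1)) => //; rewrite ltr_pwDr// real_ler_norm.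
exists (absR M + 1) => [|n]; first by rewrite addr_ge0// absR_ge0.
by rewrite -lecR absRE rmorphD /= absRE; exact: db.
Qed.

Lemma cvgseq_shift_subproof d : cvgn (fun n => d n.+1).
Proof.
by have /cvg_ex[l dl] := @cseqP _ d; apply/cvg_ex; exists l; rewrite cvg_shiftS.
Qed.

Definition cvgseq_shift d := CvgSeq (@cvgseq_shift_subproof d).

Lemma cvgseq_mul_subproof d d' : cvgn (fun n => d n * d' n).
Proof. by apply: is_cvgM; exact: cseqP. Qed.

Definition cvgseq_mul d d' := CvgSeq (@cvgseq_mul_subproof d d').

Lemma cvgseq_conj_subproof d : cvgn (fun n => (d n)^*).
Proof. by have /cvg_cplx_conj h := @cseqP _ d; apply: cvgP h. Qed.

Definition cvgseq_conj d := CvgSeq (@cvgseq_conj_subproof d).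

Lemma cvgseq1_subproof : cvgn (fun _ : nat => 1 : C).
Proof. exact: is_cvg_cst. Qed.

Definition cvgseq1 : cvgseq R := CvgSeq cvgseq1_subproof.

Lemma cvgseq_eventually_subproof (l : C) d N : cvgn (fun n => if (n < N)%N then d n else l).
Proof.
apply/cvg_ex; exists l; apply: cvg_near_cst; exists N => // n /= Nn.
by rewrite ltnNge Nn.
Qed.

Definition cvgseq_eventually l d N := CvgSeq (@cvgseq_eventually_subproof l d N).

End ConvergentSequences.

Section FockOperators.
Context {R : realType} {m : nat} {P : ncpoly (cplx R) m}.
Local Notation C := (cplx R).
Local Notation A := (ncpoly C m).
Local Notation fock := (fock P).
Implicit Types (d : cvgseq R) (x y : fock).

Lemma in_fock_bounded (x : nat -> A) (b : R) : (forall n, x n \in in_Hn P n) ->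
  (forall n, \sum_(i < n) nsq (x i) <= b) -> x \in in_fock P.
Proof.
move=> xH xb; apply/in_fockP; split=> //; apply: nondecreasing_is_cvgn.
  by apply/nondecreasing_seqP => k; rewrite /series/= big_nat_recr//= lerDl nsq_ge0.
by exists b => _ [n _ <-]; rewrite /series/= big_mkord.
Qed.

Lemma diag_subproof d x : (fun n => d n *: x n) \in in_fock P.
Proof.
have [b b0 db] := cvgseq_bounded d.
apply: (@in_fock_bounded _ (b ^+ 2 * fsq x)) => [n|n]; first exact/in_HnZ/fock_Hn.
apply: (@le_trans _ _ (\sum_(i < n) b ^+ 2 * nsq (x i))).
  apply: ler_sum => i _; rewrite nsqZE ler_wpM2r ?nsq_ge0// lerXn2r ?nnegrE//.
  exact: absR_ge0.
by rewrite -mulr_sumr ler_wpM2l ?sqr_ge0// partial_le_fsq.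
Qed.

Definition diag d x : fock := MkFock (diag_subproof d x).

Lemma diagE d x n : diag d x n = d n *: x n. Proof. by []. Qed.

Lemma diag_lin d : linear (diag d).
Proof.
by move=> c x y; apply: fock_ext => n; rewrite !(fock_linE, diagE) scalerDr !scalerA mulrC.
Qed.

Lemma diag_bounded_by d (b : R) : 0 <= b -> (forall n, absR (d n) <= b) -> bounded_by (diag d) b.
Proof.
move=> b0 db; apply/bounded_byP => // x; apply: fsq_leM => [|n]; first exact: sqr_ge0.
by rewrite diagE nsqZE ler_wpM2r ?nsq_ge0// lerXn2r ?nnegrE// absR_ge0.
Qed.

Lemma bop_diag d : bop (diag d).
Proof.
have [b b0 db] := cvgseq_bounded d; split; first exact: diag_lin.
by exists b; exact: diag_bounded_by.
Qed.

Lemma adjoint_diag d : adjoint (diag d) (diag (cvgseq_conj d)).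
Proof.
move=> x y; apply: fdotP; apply: cvgn_eq (@fdot_cvg _ _ _ x _) _ => n.
by rewrite /series/=; apply: eq_bigr => i _; rewrite dotZr dotZl conjCK.
Qed.

Lemma diag_mul d d' x : diag d (diag d' x) = diag (cvgseq_mul d d') x.
Proof. by apply: fock_ext => n; rewrite !diagE scalerA. Qed.

Lemma diag1 x : diag (cvgseq1 (R := R)) x = x.
Proof. by apply: fock_ext => n; rewrite diagE scale1r. Qed.

Lemma creation0 i x : creation i x 0%N = 0. Proof. by []. Qed.

Lemma creationS i x n : creation i x n.+1 = pj P n.+1 (lmul [:: i] (x n)).
Proof. by rewrite pj.unlock lmul.unlock. Qed.

Lemma creation_lin i : linear (creation (P := P) i).
Proof.
move=> c x y; apply: fock_ext => -[|n]; rewrite fock_linE ?creation0 ?creationS.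
  by rewrite scaler0 addr0.
by rewrite fock_linE lmul_lin pj_lin.
Qed.

Lemma nsq_pj n (p : A) : nsq (pj P n p) <= nsq p.
Proof. by rewrite pj.unlock nsq_proj. Qed.

Lemma nsq_lmul u (p : A) : nsq (lmul u p) = nsq p.
Proof. by rewrite lmul.unlock nsq_monM. Qed.

Lemma creation_bounded_by i : bounded_by (creation (P := P) i) 1.
Proof.
apply/bounded_byP => // x; rewrite expr1n mul1r; apply: fsq_le => -[|n].
  by rewrite big_ord0 fsq_ge0.
rewrite big_ord_recl creation0 nsq0 add0r; apply: le_trans (partial_le_fsq x n).
apply: ler_sum => k _; rewrite -[leLHS]/(nsq (creation i x k.+1)) creationS.
by rewrite -(nsq_lmul [:: i] (x k)) nsq_pj.
Qed.

Lemma bop_creation i : bop (creation (P := P) i).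
Proof. by split; [exact: creation_lin|exists 1; exact: creation_bounded_by]. Qed.

Lemma diag_creation d i x : diag d (creation i x) = creation i (diag (cvgseq_shift d) x).
Proof.
apply: fock_ext => -[|n]; rewrite diagE ?creation0 ?scaler0// !creationS diagE.
by rewrite -[_ *: x n]addr0 lmul_lin lmul0 addr0 pjZ.
Qed.

Fixpoint creations (w : seq 'I_m) x : fock :=
  if w is i :: w' then creation i (creations w' x) else x.

Lemma diag_creations w d : exists d', forall x, diag d (creations w x) = creations w (diag d' x).
Proof.
elim: w d => [|i w IH] d; first by exists d.
by have [d' dE] := IH (cvgseq_shift d); exists d' => x; rewrite /= diag_creation dE.
Qed.

Lemma bop_creations w : bop (creations w).
Proof.
elim: w => [|i w IH]; first exact: bop_id.
exact: (bop_comp (bop_creation i) IH).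
Qed.

Lemma creations_bounded_by w : bounded_by (creations w) 1.
Proof.
elim: w => [|i w IH]; first exact: bounded_by_id.
by have := bounded_by_comp (creation_bounded_by i) IH; rewrite mulr1.
Qed.

End FockOperators.

Section Annihilation.
Context {R : realType} {m : nat} {a : 'I_m -> cplx R}.
Local Notation C := (cplx R).
Local Notation A := (ncpoly C m).
Local Notation P := (quadratic a).
Local Notation fock := (fock P).
Implicit Types (d : cvgseq R) (x y : fock).

(** Left multiplication by X_i is isometric, so |p - X_i q|^2 = |p|^2 - |q|^2 when q is the image of
    p under its adjoint. *)
Lemma nsq_lshift i (p : A) : nsq (lshift_by [:: i] p) <= nsq p.
Proof.
set q := lshift_by _ p; have := nsq_ge0 (p + - lmul [:: i] q).
have pq : dot (lmul [:: i] q) p = (nsq q)%:C%C by rewrite dot_lmul nsqE.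
rewrite nsqDE nsqN nsq_lmul -scaleN1r dotZr rmorphN1 mulN1r dotC pq conjC_real.
rewrite raddfN /=; lra.
Qed.

Lemma annih_subproof i x : (fun n => lshift_by [:: i] (x n.+1)) \in in_fock P.
Proof.
apply: (@in_fock_bounded _ _ _ _ (fsq x)) => [n|n]; first exact/in_Hn_lshift/fock_Hn.
apply: le_trans (partial_le_fsq x n.+1); rewrite big_ord_recl.
apply: ler_wpDl; first exact: nsq_ge0.
by apply: ler_sum => k _; exact: nsq_lshift.
Qed.

Definition annih i x : fock := MkFock (annih_subproof i x).

Lemma annihE i x n : annih i x n = lshift_by [:: i] (x n.+1). Proof. by []. Qed.

Lemma annih_lin i : linear (annih i).
Proof.
by move=> c x y; apply: fock_ext => n; rewrite fock_linE !annihE fock_linE lshift_lin.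
Qed.

Lemma annih_bounded_by i : bounded_by (annih i) 1.
Proof.
apply/bounded_byP => // x; rewrite expr1n mul1r; apply: fsq_le => n.
apply: le_trans (partial_le_fsq x n.+1); rewrite big_ord_recl.
apply: ler_wpDl; first exact: nsq_ge0.
by apply: ler_sum => k _; exact: nsq_lshift.
Qed.

Lemma bop_annih i : bop (annih i).
Proof. by split; [exact: annih_lin|exists 1; exact: annih_bounded_by]. Qed.

Lemma adjoint_creation i : adjoint (creation (P := P) i) (annih i).
Proof.
move=> x y; apply: fdotP; rewrite -cvg_shiftS.
apply: cvgn_eq (@fdot_cvg _ _ _ x _) _ => n.
rewrite -[RHS]/(\sum_(0 <= k < n.+1) dot (creation i x k) (y k)) big_nat_recl//.
rewrite creation0 dot0l add0r; apply: eq_bigr => k _.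
by rewrite creationS dot_pjl ?fock_Hn// dot_lmul.
Qed.

Lemma annih_diag i d x : annih i (diag d x) = diag (cvgseq_shift d) (annih i x).
Proof.
by apply: fock_ext => n; rewrite diagE !annihE diagE -[_ *: x _]addr0 lshift_lin lshift_by0 addr0.
Qed.

(** The first letter is removed first, the reverse of the order in [creations], so that the two are
    adjoint for the same word. *)
Fixpoint annihs (w : seq 'I_m) x : fock :=
  if w is i :: w' then annihs w' (annih i x) else x.

Lemma annihsE w x n : annihs w x n = lshift_by w (x (size w + n)%N).
Proof.
elim: w x => [|i w IH] x /=; first by rewrite lshift_nil.
by rewrite IH annihE -lshift_cat.
Qed.

Lemma annihs_rcons w i x : annihs (rcons w i) x = annih i (annihs w x).
Proof. by elim: w x => //= j w IH x; rewrite IH. Qed.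

Lemma bop_annihs w : bop (annihs w).
Proof.
elim: w => [|i w IH]; first exact: bop_id.
exact: (bop_comp IH (bop_annih i)).
Qed.

Lemma annihs_bounded_by w : bounded_by (annihs w) 1.
Proof.
elim: w => [|i w IH]; first exact: bounded_by_id.
by have := bounded_by_comp IH (annih_bounded_by i); rewrite mulr1.
Qed.

Lemma adjoint_creations w : adjoint (creations (P := P) w) (annihs w).
Proof.
elim: w => [|i w IH]; first by [].
exact: (adjoint_comp (adjoint_creation i) IH).
Qed.

Lemma adjoint_annihs w : adjoint (annihs w) (creations (P := P) w).
Proof. by move=> x y; rewrite fdotC -adjoint_creations -fdotC. Qed.

(** Tested against H_{|w|+n}, the product of creations is plain left multiplication by w: all
    intermediate projections drop out. *)
Lemma dot_creations w x n g : g \in in_Hn P (size w + n) ->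
  dot (creations w x (size w + n)%N) g = dot (x n) (lshift_by w g).
Proof.
elim: w g => [|i w IH] g gH; first by rewrite lshift_nil.
rewrite -[(size (i :: w) + n)%N]/((size w + n).+1)%N in gH *.
rewrite -[creations _ x _]/(creation i (creations w x) _) creationS.
rewrite dot_pjl// dot_lmul IH; last exact: in_Hn_lshift.
by rewrite -lshift_cat.
Qed.

Lemma creations_lt w x n : (n < size w)%N -> creations w x n = 0.
Proof.
elim: w n => // i w IH [|n] nw //.
by rewrite -[creations _ x _]/(creation i (creations w x) _) creationS IH// lmul0 pj0.
Qed.

End Annihilation.

(** * Normally ordered operators *)

Section NormalOrdering.
Context {R : realType} {m : nat} {a : 'I_m -> cplx R}.
Local Notation C := (cplx R).
Local Notation P := (quadratic a).
Local Notation fock := (fock P).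
Implicit Types (d : cvgseq R) (x y : fock) (T U : fock -> fock).

(** The linear span of the words S_u D A_v, generated inductively so that each closure property
    reduces to the case of a single word. *)
Inductive normal_ordered : (fock -> fock) -> Prop :=
| normal_word u d v :
    normal_ordered (fun x => creations u (diag d (annihs v x)))
| normal_lin c T U : normal_ordered T -> normal_ordered U ->
    normal_ordered (fun x => c *: T x + U x).

Lemma normal_ext T U : normal_ordered T -> T =1 U -> normal_ordered U.
Proof. by move=> nT /funext <-. Qed.

Lemma normal0 : normal_ordered (fun=> 0).
Proof.
have h := normal_word [::] (cvgseq1 (R := R)) [::].
by apply: normal_ext (normal_lin (-1) h h) _ => x; rewrite scaleN1r addNr.
Qed.

Lemma normal_bop T : normal_ordered T -> bop T.
Proof.
elim=> [u d v|c T1 T2 _ h1 _ h2]; last exact: bop_lin.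
exact: (bop_comp (bop_creations u) (bop_comp (bop_diag d) (bop_annihs v))).
Qed.

Lemma normal_creation i T : normal_ordered T ->
  normal_ordered (fun x => creation i (T x)).
Proof.
elim=> [u d v|c T1 T2 _ h1 _ h2]; first exact: (normal_word (i :: u)).
by apply: normal_ext (normal_lin c h1 h2) _ => x; rewrite creation_lin.
Qed.

Lemma normal_creations w T : normal_ordered T ->
  normal_ordered (fun x => creations w (T x)).
Proof. by move=> nT; elim: w => //= i w; exact: normal_creation. Qed.

Lemma normal_diag d T : normal_ordered T -> normal_ordered (fun x => diag d (T x)).
Proof.
elim=> [u d1 v|c T1 T2 _ h1 _ h2].
  have [d' dE] := diag_creations (P := P) u d.
  apply: normal_ext (normal_word u (cvgseq_mul d' d1) v) _ => x.
  by rewrite dE diag_mul.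
by apply: normal_ext (normal_lin c h1 h2) _ => x; rewrite diag_lin.
Qed.

Context (a_unit : forall i, `|a i| ^+ 2 * `|a (rev_ord i)| ^+ 2 = 1).
Context (c : cvgseq R) (c0 : c 0%N = 0)
  (cS : forall n, c n.+1 * (\sum_i `|a i| ^+ 2 - c n) = 1).

Lemma annih_creation i j x : annih i (creation j x) =
  - ((a j)^* * a i) *: diag c (creation (rev_ord i) (annih (rev_ord j) x)) +
  (i == j)%:R *: x.
Proof.
apply: fock_ext => n; rewrite -[LHS]/(lshift_by [:: i] (creation j x n.+1)) creationS.
rewrite (lshift_pj_lmul a_unit c0 cS _ _ (fock_Hn x n)).
set v := pj _ _ _; have -> : v = creation (rev_ord i) (annih (rev_ord j) x) n.
  (* In degree 0 both sides vanish: a created vector has no vacuum component, and a scalar has no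
     letter to remove. *)
  rewrite /v; case: (n) => [|k]; last by rewrite creationS.
  by rewrite creation0 (tpow0_lshift _ (in_Hn_tpow (fock_Hn x 0))) lmul0 pj0.
by rewrite fock_linE fockZE diagE; exact: scaler_reassoc.
Qed.

(** The commutation relation replaces A_i S_j by S_{i'} A_{j'} up to a diagonal factor and a scalar,
    so the annihilator moves one letter to the right and becomes A_{j'}; hence the induction on u
    for all i at once. *)
Lemma normal_annih i T : normal_ordered T -> normal_ordered (fun x => annih i (T x)).
Proof.
elim=> [u d v|b T1 T2 _ h1 _ h2]; last first.
  by apply: normal_ext (normal_lin b h1 h2) _ => x; rewrite annih_lin.
elim: u i => [|j u IH] i.
  apply: normal_ext (normal_word [::] (cvgseq_shift d) (rcons v i)) _ => x.
  by rewrite /= annih_diag annihs_rcons.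
have h := normal_diag c (normal_creation (rev_ord i) (IH (rev_ord j))).
have k := normal_lin (i == j)%:R (normal_word u d v) normal0.
apply: normal_ext (normal_lin (- ((a j)^* * a i)) h k) _ => x.
by rewrite /= annih_creation addr0.
Qed.

Lemma normal_annihs w T : normal_ordered T -> normal_ordered (fun x => annihs w (T x)).
Proof.
elim/last_ind: w => // w i IH nT.
by apply: normal_ext (normal_annih i (IH nT)) _ => x; rewrite annihs_rcons.
Qed.

Lemma normal_comp T U : normal_ordered T -> normal_ordered U -> normal_ordered (T \o U).
Proof.
move=> nT nU; elim: nT => [u d v|b T1 T2 _ h1 _ h2]; last exact: (normal_lin b h1 h2).
exact/normal_creations/normal_diag/normal_annihs.
Qed.

Lemma normal_id : normal_ordered idfun.
Proof.
by apply: normal_ext (normal_word [::] (cvgseq1 (R := R)) [::]) _ => x; rewrite /= diag1.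
Qed.

Lemma normal_adjoint T : normal_ordered T -> exists2 T', normal_ordered T' & adjoint T T'.
Proof.
elim=> [u d v|b T1 T2 _ [T1' n1 h1] _ [T2' n2 h2]].
  exists (fun x => creations v (diag (cvgseq_conj d) (annihs u x))); first exact: normal_word.
  exact: (adjoint_comp (adjoint_creations u) (adjoint_comp (adjoint_diag d) (adjoint_annihs v))).
exists (fun x => b^* *: T1' x + T2' x); first exact: normal_lin.
exact: adjoint_lin.
Qed.

Lemma toeplitz_sub_closure T : toeplitz P T -> norm_closure normal_ordered T.
Proof.
apply=> [|i].
  apply: norm_closure_cstar.
  - exact: normal_bop.
  - exact: normal_id.
  - exact: normal_lin.
  - exact: normal_comp.
  - exact: normal_adjoint.
apply/norm_closureP; first exact: normal_bop.
split; first exact: bop_creation.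
apply: approx_self; apply: normal_ext (normal_creation i normal_id) _ => x //.
Qed.

End NormalOrdering.

(** * The two inclusions *)

Section EventuallyPsi.
Context {R : realType} {m : nat} {a : 'I_m -> cplx R}.
Local Notation C := (cplx R).
Local Notation A := (ncpoly C m).
Local Notation P := (quadratic a).
Local Notation fock := (fock P).
Local Notation Hn := (Hn P).
Implicit Types (d : cvgseq R) (x y : fock) (T U : fock -> fock).

Definition eventually_psi : set (fock -> fock) :=
  [set T | linfty P T /\ exists N, forall n k, (N <= n)%N ->
     psi (component T (n:=n)) = component T (n:=n + k)].

Lemma linftyP T : linfty P T <->
  bop T /\ forall n (h : Hn n) k, k != n -> T (fock_emb h) k = 0.
Proof.
split=> -[Tb Tn]; split=> // n h.
  by move=> k kn; have [g ->] := Tn _ h; rewrite fock_embE (negbTE kn).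
exists (component T h); apply: fock_ext => k; rewrite fock_embE.
by have [->//|kn] := eqVneq k n; rewrite Tn.
Qed.

Lemma eventually_psi_bop : eventually_psi `<=` bop (P := P).
Proof. by move=> T [[]]. Qed.

Lemma dot_psi n k (T : Hn n -> Hn n) (z : Hn (n + k)) (g : A) : g \in in_Hn P (n + k) ->
  dot (Hn_val (psi T z)) g =
  \sum_(v : k.-tuple 'I_m) dot (Hn_val (T (Hn_slice z v))) (slice n v g).
Proof.
move=> gH; have := dot_pjl (\sum_(v : k.-tuple 'I_m) Hn_val (T (Hn_slice z v)) * mon v) gH.
rewrite pj.unlock => ->; rewrite dot_suml; apply: eq_bigr => v _.
by apply: dot_Mmon; exact: (in_Hn_tpow (Hn_valP _)).
Qed.

(** Compatibility in weak form: testing against H_{n+k} removes the projection in [psi] and leaves a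
    sum over suffixes. *)
Lemma psi_eqP T n k : psi (component T (n:=n)) = component T (n:=n + k) <->
  forall (z : Hn (n + k)) (g : A), g \in in_Hn P (n + k) ->
    \sum_(v : k.-tuple 'I_m) dot (T (fock_emb (Hn_slice z v)) n) (slice n v g) =
    dot (T (fock_emb z) (n + k)%N) g.
Proof.
split=> [e z g gH|e].
  by rewrite -[RHS]/(dot (Hn_val (component T z)) g) -e dot_psi.
apply/funext => z; apply/val_inj; apply: (@in_Hn_ext _ _ P (n + k)).
- exact: Hn_valP.
- exact: Hn_valP.
- by move=> g gH; rewrite dot_psi//; exact: e.
Qed.

Lemma eventually_psi_lin c T U : eventually_psi T -> eventually_psi U ->
  eventually_psi (fun x => c *: T x + U x).
Proof.
move=> [/linftyP[Tb Tn] [N TN]] [/linftyP[Ub Un] [N' UN]]; split.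
  apply/linftyP; split; first exact: bop_lin.
  by move=> n h k kn; rewrite fock_linE Tn// Un// scaler0 addr0.
exists (maxn N N') => n k; rewrite geq_max => /andP[Nn Nn'].
apply/psi_eqP => z g gH; rewrite fock_linE dotPl.
rewrite -(psi_eqP T n k).1; [|exact: TN|exact: gH].
rewrite -(psi_eqP U n k).1; [|exact: UN|exact: gH].
by rewrite mulr_sumr -big_split; apply: eq_bigr => v _; rewrite fock_linE dotPl.
Qed.

Lemma dot_word u d v x k g : g \in in_Hn P (size u + k) ->
  dot (creations u (diag d (annihs v x)) (size u + k)%N) g =
  d k * dot (lshift_by v (x (size v + k)%N)) (lshift_by u g).
Proof. by move=> gH; rewrite dot_creations// diagE dotZl annihsE. Qed.

Lemma word_eq0 u d v x n : (forall k, n = (size u + k)%N -> x (size v + k)%N = 0) ->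
  creations u (diag d (annihs v x)) n = 0.
Proof.
have [nu _|un] := ltnP n (size u); first exact: creations_lt.
move=> h; have nE : n = (size u + (n - size u))%N by rewrite subnKC.
apply: (@in_Hn_ext _ _ P n); [exact: fock_Hn|exact: in_Hn0|].
rewrite nE => g gH; rewrite dot_word// (h _ nE) lshift_by0 !dot0l mulr0//.
Qed.

Lemma word_emb u d v x n : size u = size v ->
  creations u (diag d (annihs v x)) n = creations u (diag d (annihs v (emb n x))) n.
Proof.
move=> uv; have [nu|un] := ltnP n (size u); first by rewrite !creations_lt.
rewrite -(subnKC un); move: (n - size u)%N => k.
apply: (@in_Hn_ext _ _ P (size u + k)); [exact: fock_Hn|exact: fock_Hn|move=> g gH].
by rewrite (dot_word _ _ _ gH) (dot_word _ _ _ gH) embE uv eqxx.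
Qed.

(** Cutting suffixes commutes with removing the prefixes u and v, and by [dot_slice] the inner
    product in degree j + k is the sum of those of the slices in degree j. The diagonal factor is
    the same number l in both degrees. *)
Lemma word_eventually_psi u d v l N : size u = size v ->
  eventually_psi (fun x => creations u (diag (cvgseq_eventually l d N) (annihs v x))).
Proof.
move=> uv; split.
  apply/linftyP; split; first exact: normal_bop (normal_word _ _ _).
  move=> n h k kn; apply: word_eq0 => j kE.
  by rewrite fock_embE -uv -kE (negbTE kn).
(* The shift by |u| is there because the diagonal operator acts after |v| = |u| letters have been
   removed. *)
exists (size u + N)%N => n k Nn; apply/psi_eqP => z g gH.
have un : (size u <= n)%N by apply: leq_trans Nn; rewrite leq_addr.
have nE : n = (size u + (n - size u))%N by rewrite subnKC.
have Nn' : (N <= n - size u)%N by rewrite leq_subRL.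
move: (n - size u)%N nE Nn' => j nE Nj; subst n.
have gH' : g \in in_Hn P (size u + (j + k)) by rewrite addnA.
have wE x : dot (creations u (diag (cvgseq_eventually l d N) (annihs v x)) (size u + j + k)%N) g =
    cvgseq_eventually l d N (j + k)%N * dot (lshift_by v (x (size v + (j + k))%N)) (lshift_by u g).
  by rewrite -addnA dot_word.
rewrite wE fock_embE -uv addnA eqxx.
have dE i : (j <= i)%N -> cvgseq_eventually l d N i = l.
  by move=> ji; rewrite /= ltnNge (leq_trans Nj ji).
rewrite dE ?leq_addr// (@dot_slice _ _ j k); last first.
  by apply: tpow_lshift; rewrite -uv addnA; exact/in_Hn_tpow/Hn_valP.
rewrite mulr_sumr; apply: eq_bigr => w _; rewrite dot_word; last exact: slice_Hn.
have lsl (z0 : A) : lshift_by v (slice (size u + j) w z0) = slice j w (lshift_by v z0).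
  by rewrite uv slice_lshift.
by rewrite fock_embE -uv eqxx (dE j (leqnn j)) lsl (slice_lshift j u w g).
Qed.

Lemma cvgseq_sub_subproof d d' : cvgn (fun n => d n - d' n).
Proof. by apply: is_cvgB; exact: cseqP. Qed.

Definition cvgseq_sub d d' := CvgSeq (@cvgseq_sub_subproof d d').

Lemma word_approx u d v : size u = size v ->
  op_approx eventually_psi (fun x => creations u (diag d (annihs v x))).
Proof.
move=> uv e e0; have /cvg_ex[l /cvg_cplxP/(_ _ e0)[N _ dN]] := @cseqP _ d.
pose d' := cvgseq_eventually l d N.
exists (fun x => creations u (diag d' (annihs v x))); first exact: word_eventually_psi.
(* The difference is S_u (D - D') A_v, and D - D' is zero before N and at most e from N on. *)
rewrite (_ : _ \- _ = creations u \o (diag (cvgseq_sub d d') \o annihs v)).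
  apply: (@bounded_by_le _ _ _ _ (1 * (e * 1))); last by rewrite mul1r mulr1.
  apply: bounded_by_comp; first exact: creations_bounded_by.
  apply: bounded_by_comp; last exact: annihs_bounded_by.
  apply: diag_bounded_by => [|n]; first exact: ltW.
  rewrite -lecR absRE /=; case: ltnP => [_|Nn]; first by rewrite subrr normr0 ler0c ltW.
  by rewrite distrC; exact: dN.
apply/funext => x; rewrite /= -(opB (bop_creations (P := P) u).1); congr creations.
apply: fock_ext => n; rewrite fockBE !diagE -scalerBl//.
Qed.

Lemma eventually_psi0 : eventually_psi (fun=> 0).
Proof.
have h := @word_eventually_psi [::] (cvgseq1 (R := R)) [::] 1 0 erefl.
rewrite (_ : (fun=> 0) = (fun x : fock => -1 *: creations [::] (diag (cvgseq_eventually 1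
  (cvgseq1 (R := R)) 0) (annihs [::] x)) + creations [::] (diag (cvgseq_eventually 1
  (cvgseq1 (R := R)) 0) (annihs [::] x)))); first exact: (eventually_psi_lin (-1) h h).
by apply/funext => x; rewrite scaleN1r addNr.
Qed.

(** The diagonal part of U, usually an average over the gauge action, is obtained here termwise:
    words with |u| = |v| preserve the degree and are kept, the others have zero diagonal part. *)
Lemma normal_diagonal_part U : normal_ordered U ->
  exists2 U0, norm_closure eventually_psi U0 & forall x n, U0 x n = U (emb n x) n.
Proof.
have clP V := norm_closureP V eventually_psi_bop.
elim=> [u d v|c T1 T2 _ [V1 /clP[b1 a1] e1] _ [V2 /clP[b2 a2] e2]]; last first.
  exists (fun x => c *: V1 x + V2 x); last by move=> x n; rewrite !fock_linE e1 e2.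
  apply/clP; split; first exact: bop_lin.
  by apply: approx_lin a1 a2 => T' U'; exact: eventually_psi_lin.
have [uv|uv] := eqVneq (size u) (size v).
  exists (fun x => creations u (diag d (annihs v x))); last by move=> x n; exact: word_emb.
  by apply/clP; split; [exact: normal_bop (normal_word _ _ _)|exact: word_approx].
exists (fun=> 0).
  apply/clP; split; first exact: eventually_psi_bop eventually_psi0.
  exact/approx_self/eventually_psi0.
move=> x n; rewrite fock0E word_eq0// => k nE.
by rewrite embE nE eqn_add2r eq_sym (negbTE uv).
Qed.

Lemma fsq_emb n x : fsq (emb n x) = nsq (x n).
Proof.
rewrite (@fsq_single _ _ _ _ n) => [|k /negbTE kn]; first by rewrite embE eqxx.
by rewrite embE kn.
Qed.

Lemma gauge_emb z (z1 : `|z| = 1) n (h : Hn n) :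
  gauge z1 (fock_emb h) = z ^+ n *: fock_emb h.
Proof.
apply: fock_ext => k; rewrite fockZE -[LHS]/(z ^+ k *: fock_emb h k) fock_embE.
by case: eqP => [->|_]; rewrite ?scaler0.
Qed.

Lemma phase_exists (n k : nat) : n != k -> exists2 z : C, `|z| = 1 & z ^+ n != z ^+ k.
Proof.
wlog nk : n k / (n < k)%N => [hw|_].
  rewrite neq_ltn => /orP[/[dup] nk|/[dup] nk]; rewrite ltn_neqAle => /andP[ne _].
    exact: hw.
  by have [z z1] := hw _ _ nk ne; rewrite eq_sym => zk; exists z.
have d0 : (0 < k - n)%N by rewrite subn_gt0.
(* A root of -1 of order k - n gives z^k = - z^n. *)
pose z : C := (k - n).-root (-1); have zd : z ^+ (k - n) = -1 by exact: rootCK.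
have z1 : `|z| = 1 by apply/eqP; rewrite -(pexpr_eq1 d0)// -normrX zd normrN1.
exists z => //; rewrite -(subnKC (ltnW nk)) exprD zd mulrN1 -addr_eq0 -mulr2n mulrn_eq0/=.
by rewrite expf_eq0 -normr_eq0 z1 oner_eq0 andbF.
Qed.

Lemma gauge_diag T : bop T -> (forall z (z1 : `|z| = 1), gauge_action z1 T = T) ->
  forall x n, T x n = T (emb n x) n.
Proof.
move=> Tb Tg x n; apply: (diag_apply Tb) => k h kn.
rewrite eq_sym in kn; have [z z1 zkn] := phase_exists kn.
(* Conjugation by the gauge unitaries multiplies the block of T from H_k to H_n by z^n z^{-k}, which
   differs from 1 for this z. *)
have : gauge z1 (T (gauge (norm1V z1) (fock_emb h))) n = T (fock_emb h) n.
  by rewrite -[in RHS](Tg z z1).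
rewrite gauge_emb (opZ Tb.1) -[LHS]/(z ^+ n *: (z^-1 ^+ k *: T (fock_emb h) n)).
move: (T _ n) => v /eqP; rewrite scalerA -subr_eq0 -[X in _ - X]scale1r -scalerBl.
rewrite scaler_eq0 subr_eq0 => /orP[|/eqP//].
rewrite exprVn; have zk0 : z ^+ k != 0.
  by rewrite expf_eq0 -normr_eq0 z1 oner_eq0 andbF.
by rewrite -(inj_eq (mulIf zk0)) divfK// mul1r (negbTE zkn).
Qed.

Lemma toeplitz0_sub_Cbar (a_unit : forall i, `|a i| ^+ 2 * `|a (rev_ord i)| ^+ 2 = 1)
    (c : cvgseq R) (c0 : c 0%N = 0)
    (cS : forall n, c n.+1 * (\sum_i `|a i| ^+ 2 - c n) = 1) :
  toeplitz0 P `<=` Cbar P.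
Proof.
move=> T [/(toeplitz_sub_closure a_unit c0 cS) Tcl Tg].
have [Tb Ta] := (norm_closureP T (@normal_bop _ _ a)).1 Tcl.
have Td := gauge_diag Tb Tg.
apply/(norm_closureP T eventually_psi_bop); split; first exact: Tb.
apply: (@approx_trans _ _ _ _ (norm_closure eventually_psi)).
  by move=> U /(norm_closureP U eventually_psi_bop)[].
move=> e e0; have [U nU TU] := Ta e e0; have [U0 cU0 U0E] := normal_diagonal_part nU.
exists U0; first exact: cU0.
apply/bounded_byP => [|x]; first exact: ltW.
apply: fsq_leM => [|n]; first exact: sqr_ge0.
(* Both T and U0 are read off blockwise, so the component n of (T - U0) x is that of T - U applied
   to the block x_n alone: passing to the diagonal part does not enlarge the error. *)
rewrite -[(T \- U0) x n]/(T x n - U0 x n) Td U0E -fsq_emb.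
apply: le_trans (nsq_le_fsq ((T \- U) (emb n x)) n) _.
exact: ((bounded_byP _ (ltW e0)).1 TU).
Qed.

Lemma gauge_inv T : bop T -> (forall n (h : Hn n) k, k != n -> T (fock_emb h) k = 0) ->
  forall z (z1 : `|z| = 1), gauge_action z1 T = T.
Proof.
move=> Tb Tn z z1.
have Td x n : T x n = T (emb n x) n.
  by apply: (diag_apply Tb) => k h kn; apply: Tn; rewrite eq_sym.
apply/funext => x; apply: fock_ext => n.
rewrite -[LHS]/(z ^+ n *: T (gauge (norm1V z1) x) n) Td [in RHS]Td.
have -> : emb n (gauge (norm1V z1) x) = z^-1 ^+ n *: emb n x.
  apply: fock_ext => k; rewrite fockZE !embE; case: eqP => [_//|_].
  by rewrite scaler0.
rewrite (opZ Tb.1) fockZE scalerA -exprMn divff ?expr1n ?scale1r//.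
by rewrite -normr_eq0 z1 oner_eq0.
Qed.

(** The approximants have zero off-diagonal blocks, so those of T coincide with blocks of T - U and
    are arbitrarily small. *)
Lemma op_approx_offdiag B T : (forall U, B U -> linfty P U) -> op_approx B T ->
  forall n (h : Hn n) k, k != n -> T (fock_emb h) k = 0.
Proof.
move=> Bl TB n h k kn; apply: dot_eq0; rewrite -nsqE.
suff -> : nsq (T (fock_emb h) k) = 0 by [].
apply/eqP; rewrite eq_le nsq_ge0 andbT; apply/ler_addgt0Pr => e e0; rewrite add0r.
pose b := fsq (fock_emb h); have b0 : 0 <= b := fsq_ge0 _.
(* Chosen so that the squared bound times |h|^2 = b is at most e. *)
have s0 : 0 < Num.sqrt (e / (b + 1)) by rewrite sqrtr_gt0 divr_gt0// ltr_wpDl.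
have [U /Bl/linftyP[Ub Un] TU] := TB _ s0.
have -> : T (fock_emb h) k = (T \- U) (fock_emb h) k.
  by rewrite -[RHS]/(T (fock_emb h) k - U (fock_emb h) k) Un// subr0.
apply: le_trans (nsq_le_fsq _ _) _.
apply: le_trans ((bounded_byP _ (ltW s0)).1 TU _) _.
have q0 : 0 <= e / (b + 1) by rewrite divr_ge0 ?addr_ge0// ltW.
rewrite (sqr_sqrtr q0) -/b mulrAC -mulrA ler_piMr ?(ltW e0)//.
by rewrite ler_pdivrMr ?ltr_wpDl// mul1r lerDl.
Qed.

End EventuallyPsi.

(** * The inclusion of C(FO_P) in the Toeplitz algebra *)

Section CompactificationInToeplitz.
Context {R : realType} {m : nat} {a : 'I_m -> cplx R}.
Local Notation C := (cplx R).
Local Notation A := (ncpoly C m).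
Local Notation P := (quadratic a).
Local Notation fock := (fock P).
Local Notation Hn := (Hn P).
Implicit Types (x y : fock) (T U : fock -> fock).

Definition vacuum_proj x : fock := x - \sum_i creation i (annih i x).

Lemma vacuum_projE x n : vacuum_proj x n = if n == 0%N then x n else 0.
Proof.
rewrite /vacuum_proj fockBE fock_sumE; case: n => [|n].
  by rewrite big1 ?subr0// => i _; rewrite creation0.
under eq_bigr do rewrite creationS annihE.
have xH := fock_Hn x n.+1.
by rewrite -pj_sum -(lshift_expand (in_Hn_tpow xH)) (pj_id xH) subrr.
Qed.

(** The matrix, in the basis of words, of the block U_n extended by 0 to H^{(x)n}. The vectors
    f_n(X_v) span H_n without being independent in general, so words of the tensor power are used
    instead of a basis of H_n. *)
Definition matrix_coef U n (u v : seq 'I_m) : C :=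
  coef (U (fock_emb (proj_Hn P n (mon v))) n) u.

Lemma matrix_coefP U n (h : Hn n) (g : A) : linear U ->
  dot (U (fock_emb h) n) g = \sum_(u : n.-tuple 'I_m) \sum_(v : n.-tuple 'I_m)
    matrix_coef U n u v * (coef h v * (coef g u)^*).
Proof.
move=> Ul; have hE : fock_emb h =
    \sum_(v : n.-tuple 'I_m) coef h v *: fock_emb (proj_Hn P n (mon v)).
  apply: fock_ext => k; rewrite fock_sumE.
  have hH := Hn_valP h; have th := in_Hn_tpow hH.
  under eq_bigr => v _ do rewrite fockZE fock_embE.
  rewrite fock_embE; case: eqP => _; last by rewrite big1// => v _; rewrite scaler0.
  (* Writing h as f_n h, its expansion in words becomes one in the vectors f_n(X_v) of H_n. *)
  rewrite -{1}(pj_id hH).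
  have {1}-> : Hn_val h = \sum_(v : n.-tuple 'I_m) coef h v *: mon v.
    apply/coefP => w; rewrite coef_sum; under eq_bigr do rewrite coefZ_mon.
    have [/eqP sw|sw] := eqVneq (size w) n; last first.
      rewrite (tpow_size th sw) big1// => v _; rewrite ifF//.
      by apply: contraNF sw => /eqP <-; rewrite size_tuple.
    rewrite (bigD1 (Tuple sw))//= eqxx big1 ?addr0// => v vw; rewrite ifF//.
    by apply: contraNF vw => /eqP e; apply/eqP/val_inj.
  by rewrite pj_sum; apply: eq_bigr => v _; rewrite pjZ pj.unlock.
rewrite hE (op_sum Ul) fock_sumE dot_suml.
under eq_bigr => v _.
  rewrite (opZ Ul) fockZE dotZl (dot_tuple _ (in_Hn_tpow (fock_Hn _ n))) mulr_sumr.
  over.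
rewrite exchange_big; apply: eq_bigr => u _; apply: eq_bigr => v _.
by rewrite mulrCA.
Qed.

Section InSubalgebra.
Context (B : set (fock -> fock)) (Balg : unital_cstar_subalgebra B).
Context (Bcreation : forall i, B (creation i)).

Lemma subalg_lin c T U : B T -> B U -> B (fun x => c *: T x + U x).
Proof. by case: Balg => _ _ h _ _; exact: h. Qed.

Lemma subalg_comp T U : B T -> B U -> B (T \o U).
Proof. by case: Balg => _ _ _ h _; exact: h. Qed.

Lemma subalg_id : B idfun.
Proof. by case: Balg. Qed.

Lemma subalg0 : B (fun=> 0).
Proof.
rewrite (_ : (fun=> 0) = (fun x : fock => -1 *: idfun x + idfun x)).
  by apply: subalg_lin; exact: subalg_id.
by apply/funext => x; rewrite scaleN1r addNr.
Qed.

Lemma subalg_sum I r (Q : pred I) (c : I -> C) (F : I -> fock -> fock) :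
  (forall i, B (F i)) -> B (fun x => \sum_(i <- r | Q i) c i *: F i x).
Proof.
move=> BF; elim: r => [|i r IH].
  rewrite (_ : (fun x => _) = fun=> 0); first exact: subalg0.
  by apply/funext => x; rewrite big_nil.
rewrite (_ : (fun x => _) = if Q i then
  fun x => c i *: F i x + \sum_(i <- r | Q i) c i *: F i x else
  fun x => \sum_(i <- r | Q i) c i *: F i x).
  by case: ifP => // _; exact: subalg_lin.
by apply/funext => x; rewrite big_cons; case: ifP.
Qed.

Lemma subalg_annih i : B (annih i).
Proof.
case: Balg => _ _ _ _ [h _].
exact: (h _ _ (Bcreation i) (bop_annih i) (adjoint_creation i)).
Qed.

Lemma subalg_creations w : B (creations w).
Proof. by elim: w => [|i w IH]; [exact: subalg_id|exact: (subalg_comp (Bcreation i) IH)]. Qed.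

Lemma subalg_annihs w : B (annihs w).
Proof. by elim: w => [|i w IH]; [exact: subalg_id|exact: (subalg_comp IH (subalg_annih i))]. Qed.

Lemma subalg_vacuum_proj : B vacuum_proj.
Proof.
rewrite (_ : vacuum_proj = fun x => -1 *: (\sum_i 1 *: (creation i \o annih i) x) + idfun x).
  apply: (@subalg_lin (-1) (fun x => \sum_i 1 *: (creation i \o annih i) x) idfun).
    apply: (@subalg_sum _ _ _ (fun=> 1) (fun i => creation i \o annih i)) => i.
    exact: (subalg_comp (Bcreation i) (subalg_annih i)).
  exact: subalg_id.
apply/funext => x; rewrite /vacuum_proj scaleN1r addrC; congr (- _ + _).
by apply: eq_bigr => i _; rewrite scale1r.
Qed.

(** The block of U on H_n, extended by 0: S_u e_0 A_v sends x to the coefficient of v in x_n times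
    f_n(X_u). *)
Definition degree_part U n x : fock :=
  \sum_(uv : n.-tuple 'I_m * n.-tuple 'I_m) matrix_coef U n uv.1 uv.2 *:
    creations uv.1 (vacuum_proj (annihs uv.2 x)).

(** Without the vacuum projection, the same combination acts on H_{N+k} as psi_{N,N+k}(U_N) for
    every k. *)
Definition tail_part U N x : fock :=
  \sum_(uv : N.-tuple 'I_m * N.-tuple 'I_m) matrix_coef U N uv.1 uv.2 *:
    creations uv.1 (annihs uv.2 x).

Lemma subalg_degree_part U n : B (degree_part U n).
Proof.
refine (@subalg_sum _ (index_enum _) xpredT
  (fun uv : n.-tuple 'I_m * n.-tuple 'I_m => matrix_coef U n uv.1 uv.2)
  (fun uv => creations uv.1 \o (vacuum_proj \o annihs uv.2)) _) => uv.
exact: (subalg_comp (subalg_creations _) (subalg_comp subalg_vacuum_proj (subalg_annihs _))).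
Qed.

Lemma subalg_tail_part U N : B (tail_part U N).
Proof.
refine (@subalg_sum _ (index_enum _) xpredT
  (fun uv : N.-tuple 'I_m * N.-tuple 'I_m => matrix_coef U N uv.1 uv.2)
  (fun uv => creations uv.1 \o annihs uv.2) _) => uv.
exact: (subalg_comp (subalg_creations _) (subalg_annihs _)).
Qed.

End InSubalgebra.

Lemma dot_creations_tuple N (u : N.-tuple 'I_m) x k g : g \in in_Hn P (N + k) ->
  dot (creations u x (N + k)%N) g = dot (x k) (lshift_by u g).
Proof.
move=> gH; have su := size_tuple u.
by have := @dot_creations _ _ a u x k g; rewrite su; apply.
Qed.

Lemma annihs_tuple N (v : N.-tuple 'I_m) x k :
  annihs v x k = lshift_by v (x (N + k)%N).
Proof. by rewrite annihsE size_tuple. Qed.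

Lemma degree_partE U n x k : linear U ->
  degree_part U n x k = if k == n then U (emb n x) n else 0.
Proof.
move=> Ul; rewrite /degree_part fock_sumE; have [kn|nk] := ltnP k n.
  rewrite ltn_eqF// big1// => uv _.
  by rewrite fockZE creations_lt ?scaler0// size_tuple.
have kE : k = (n + (k - n))%N by rewrite subnKC.
move: (k - n)%N kE => j kE; subst k.
have -> : (n + j == n)%N = (j == 0%N) by rewrite -[X in _ == X]addn0 eqn_add2l.
have [j0|j0] := eqVneq j 0%N; last first.
  rewrite big1// => uv _; rewrite fockZE.
  suff -> : creations uv.1 (vacuum_proj (annihs uv.2 x)) (n + j)%N = 0 by rewrite scaler0.
  apply: (@in_Hn_ext _ _ P (n + j)); [exact: fock_Hn|exact: in_Hn0|move=> g gH].
  by rewrite dot_creations_tuple// vacuum_projE (negbTE j0) !dot0l.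
subst j; rewrite addn0 -fock_sumE.
apply: (@in_Hn_ext _ _ P n); [exact: fock_Hn|exact: fock_Hn|move=> g gH].
rewrite fock_sumE dot_suml matrix_coefP// pair_big; apply: eq_bigr => uv _.
rewrite fockZE dotZl; congr (_ * _).
have gH0 : g \in in_Hn P (n + 0) by rewrite addn0.
have xt : tpow 0 (lshift_by uv.2 (x n)).
  by apply: tpow_lshift; rewrite size_tuple addn0; exact: in_Hn_tpow (fock_Hn x n).
rewrite -[X in creations _ _ X]addn0 dot_creations_tuple// vacuum_projE eqxx annihs_tuple addn0.
(* In degree 0 only the empty word remains, so the inner product is a coefficient of x_n times a
   conjugate coefficient of [g]. *)
rewrite (dot_tuple _ xt) (bigD1 [tuple])//= !coef_lshift !cats0.
by rewrite big1 ?addr0// => t; rewrite tuple0.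
Qed.

Lemma tail_part_lt U N x k : (k < N)%N -> tail_part U N x k = 0.
Proof.
move=> kN; rewrite /tail_part fock_sumE big1// => uv _.
by rewrite fockZE creations_lt ?scaler0// size_tuple.
Qed.

(** Compatibility expresses U_{N+k} through U_N on slices; for fixed u and v, the sum over suffixes
    recombines into the inner product of x_{N+k} without v and g without u. *)
Lemma tail_part_ge U N x k : linear U ->
  psi (component U (n:=N)) = component U (n:=N + k) ->
  tail_part U N x (N + k)%N = U (emb (N + k) x) (N + k)%N.
Proof.
move=> Ul /psi_eqP Upsi; apply: (@in_Hn_ext _ _ P (N + k)); [exact: fock_Hn|exact: fock_Hn|].
move=> g gH; rewrite -[emb _ x]/(fock_emb (fock_comp (N + k) x)) -Upsi//.
rewrite /tail_part fock_sumE dot_suml.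
under [RHS]eq_bigr => w _ do rewrite matrix_coefP// pair_big.
rewrite exchange_big; apply: eq_bigr => uv _; rewrite fockZE dotZl -mulr_sumr.
congr (_ * _); rewrite dot_creations_tuple// annihs_tuple.
rewrite (@dot_tuple _ _ k); last first.
  by apply: tpow_lshift; rewrite size_tuple; exact: in_Hn_tpow (fock_Hn _ _).
apply: eq_bigr => w _; rewrite !coef_lshift.
by congr (_ * _^*); symmetry; exact: coef_slice_tuple.
Qed.

Lemma eventually_psi_sub_toeplitz : eventually_psi (a := a) `<=` toeplitz P.
Proof.
move=> U [/linftyP[Ub Un] [N UN]] B Balg Bc.
have Ud x n : U x n = U (emb n x) n.
  by apply: (diag_apply Ub) => k h kn; apply: Un; rewrite eq_sym.
(* The tail takes care of all degrees from N on, and the finitely many blocks below N are added one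
   by one. *)
rewrite (_ : U = fun x => 1 *: tail_part U N x + \sum_(n < N) 1 *: degree_part U n x).
  apply: (@subalg_lin B Balg 1 (tail_part U N)); first exact: subalg_tail_part.
  refine (@subalg_sum B Balg _ (index_enum _) xpredT (fun=> 1)
    (fun n : 'I_N => degree_part U n) _) => n.
  exact: subalg_degree_part.
apply/funext => x; apply: fock_ext => k; rewrite fockDE fockZE scale1r [X in _ + X]fock_sumE.
rewrite (eq_bigr (fun n : 'I_N => if k == n then U (emb n x) n else 0)) => [|n _]; last first.
  by rewrite scale1r degree_partE//; exact: Ub.1.
have [kN|Nk] := ltnP k N.
  rewrite tail_part_lt// add0r (bigD1 (Ordinal kN))//= eqxx big1 ?addr0 -?Ud// => i ik.
  by rewrite ifF//; apply: contraNF ik => /eqP e; apply/eqP/val_inj.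
have kE : k = (N + (k - N))%N by rewrite subnKC.
rewrite big1 ?addr0 => [|i _]; last first.
  by rewrite ifF//; apply/negbTE; rewrite neq_ltn (leq_trans (ltn_ord i) Nk) orbT.
by rewrite {1}Ud kE tail_part_ge//; [exact: Ub.1|exact: UN].
Qed.

Lemma Cbar_sub_toeplitz0 : Cbar P `<=` toeplitz0 P.
Proof.
move=> T Tc; have [Tb Ta] := (norm_closureP T (@eventually_psi_bop _ _ a)).1 Tc.
split; last first.
  apply: gauge_inv Tb _; apply: op_approx_offdiag Ta => U [].
  by [].
move=> B Balg Bc; case: (Balg) => _ _ _ _ [_]; apply; split; first exact: Tb.
move=> e e0; have [_ /(_ e e0)[U UG TU]] := Tc; exists U; last exact: TU.
exact: (eventually_psi_sub_toeplitz UG Balg Bc).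
Qed.

End CompactificationInToeplitz.

(** * The scalar recursion for the Wenzl coefficients *)

Section WenzlCoefficients.
Context {R : realType} (d : R) (d2 : 2 <= d).

Fixpoint wenzl_coef n : R := if n is k.+1 then (d - wenzl_coef k)^-1 else 0.

(** For d >= 2 the map z -> 1/(d - z) preserves [0, 1], since d - z >= 1 there; this also keeps the
    denominators nonzero. *)
Lemma wenzl_coef_bounds n : 0 <= wenzl_coef n <= 1.
Proof.
elim: n => [|n] /=; first by rewrite lexx ler01.
have := d2; move: (wenzl_coef n) => z d2' /andP[z0 z1]; have h : 1 <= d - z by lra.
by rewrite invr_ge0 invf_le1 ?(lt_le_trans ltr01)// h (le_trans ler01).
Qed.

Lemma wenzl_coefS n : wenzl_coef n.+1 * (d - wenzl_coef n) = 1.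
Proof.
have /andP[_] := wenzl_coef_bounds n; have := d2; rewrite /=.
move: (wenzl_coef n) => z d2' z1.
by rewrite mulVf// gt_eqF//; lra.
Qed.

(** The map z -> 1/(d - z) is increasing on [0, 1] and the first step goes up from 0, so the
    sequence is monotone and bounded. *)
Lemma wenzl_coef_cvg : cvgn wenzl_coef.
Proof.
apply: nondecreasing_is_cvgn; last first.
  by exists 1 => _ [n _ <-]; have /andP[] := wenzl_coef_bounds n.
apply/nondecreasing_seqP; elim=> [|n IH].
  by have /andP[] := wenzl_coef_bounds 1.
have /andP[_ c1] := wenzl_coef_bounds n; have /andP[_ c2] := wenzl_coef_bounds n.+1.
rewrite -[leLHS]/((d - wenzl_coef n)^-1) -[leRHS]/((d - wenzl_coef n.+1)^-1).
have := d2; move: (wenzl_coef n) (wenzl_coef n.+1) IH c1 c2 => y z yz y1 z1 d2'.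
by rewrite lef_pV2 ?posrE; lra.
Qed.

End WenzlCoefficients.

Theorem theorem4p1 (R : realType) (m : nat) (a : 'I_m -> cplx R) (tau : cplx R) :
  (2 <= m)%N ->
  (forall i : 'I_m, a i != 0) ->
  tau = -1 \/ tau = 1 ->
  (forall i : 'I_m, a i * (a (rev_ord i))^* = - tau) ->
  2 < \sum_(i < m) `|a i| ^+ 2 ->
  toeplitz0 (quadratic a) = Cbar (quadratic a).
Proof.
move=> _ _ tau1 aa a2.
(* Taking moduli in the relation between a_i and a_{i'}, with |tau| = 1. *)
have a_unit i : `|a i| ^+ 2 * `|a (rev_ord i)| ^+ 2 = 1.
  rewrite -exprMn -(norm_conjC (a (rev_ord i))) -normrM aa normrN.
  by case: tau1 => ->; rewrite ?normrN1 ?normr1 expr1n.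
(* The sum of the |a_i|^2 is a nonnegative complex number; the recursion is run on its real part,
   where order and monotone convergence are available. *)
pose d := complex.Re (\sum_(i < m) `|a i| ^+ 2).
have dE : (d%:C%C : cplx R) = \sum_(i < m) `|a i| ^+ 2.
  by apply: RRe_real; apply: ger0_real; apply: sumr_ge0 => i _; exact: exprn_ge0.
have d2 : 2 <= d.
  by rewrite -lecR [leRHS]dE ltW//; apply: le_lt_trans a2; rewrite rmorph_nat.
have [l cl] := (cvg_ex _).1 (wenzl_coef_cvg d2).
pose c : cvgseq R := CvgSeq (cvgP _ (cvg_cplx_real cl)).
have c0 : c 0%N = 0 by [].
have cS n : c n.+1 * (\sum_i `|a i| ^+ 2 - c n) = 1.
  rewrite -dE -[c n.+1]/((wenzl_coef d n.+1)%:C%C) -[c n]/((wenzl_coef d n)%:C%C).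
  by rewrite -rmorphB -rmorphM (wenzl_coefS d2).
apply/seteqP; split; first exact: (toeplitz0_sub_Cbar a_unit c0 cS).
exact: Cbar_sub_toeplitz0.
Qed.
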